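(* Let $X$ be a Banach space of analytic functions on $\mathbb{D}$ satisfying the standing assumptions (i)–(iv) listed in the context, with Cauchy dual $X'$, and let $\vartheta$ be an inner function. Then the pair $(X,\vartheta)$ satisfies the $(P)$-property, i.e. $[\vartheta]_{X'}\cap H^2\subseteq\vartheta H^2$, if and only if $X\cap K^2_\vartheta$ is dense in $K^2_\vartheta$ (in the $H^2$-norm).
   Context: $\mathbb{D}$ is the open unit disc, $\mathbb{T}$ the unit circle, $m$ normalized arc length measure on $\mathbb{T}$, $H^2$ the classical Hardy space on $\mathbb{D}$ (functions identified with their boundary functions in $L^2(\mathbb{T},m)$), and $H^2_0=\{f\in H^2: f(0)=0\}$. An inner function is a bounded analytic function $\vartheta$ on $\mathbb{D}$ with $|\vartheta|=1$ $m$-a.e. on $\mathbb{T}$. $K^2_\vartheta := H^2\cap\vartheta\overline{H^2_0}$ (in the sense of boundary functions), where $\overline{H^2_0}$ is the set of complex conjugates on $\mathbb{T}$ of functions in $H^2_0$; it is the orthogonal complement of $\vartheta H^2$ in $H^2$. Standing assumptions on the Banach space $X$ of analytic functions on $\mathbb{D}$: (i) the analytic polynomials $\mathcal{P}$ are contained and dense in $X$; (ii) $\limsup_{n\to\infty}\|z^n\|_X^{1/n}\leq1$; (iii) $X$ is continuously embedded in $H^2$; (iv) for every $f\in X$ and $0<r<1$ the dilation $f_r(z):=f(rz)$ belongs to $X$, and $\|f-f_r\|_X\to0$ as $r\to1-$. Cauchy dual: let $X^*$ be the Banach space dual of $X$. For $\Lambda\in X^*$ put $\mathcal{L}(\Lambda)(z):=\sum_{n\geq0}\overline{\Lambda(\zeta^n)}z^n$,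 $z\in\mathbb{D}$, where $\zeta^n$ denotes the $n$-th monomial. The conjugate-linear map $\mathcal{L}$ is injective into the analytic functions on $\mathbb{D}$; its image is denoted $X'$ and normed by $\|\mathcal{L}(\Lambda)\|_{X'}:=\|\Lambda\|_{X^*}$. Thus $X'$ is the dual of $X$ under the pairing $\lim_{r\to1-}\int_{\mathbb{T}}f(r\zeta)\overline{g(r\zeta)}\,dm(\zeta)$, $f\in X$, $g\in X'$, and $X'\supseteq H^2$. The weak-star topology on $X'$ is the one transported from $X^*=(X)^*$ by $\mathcal{L}$. $[\vartheta]_{X'}$ denotes the weak-star closure in $X'$ of $\{\vartheta q: q\in\mathcal{P}\}$. *)

(* Defs.v *)
From HB Require Import structures.
From mathcomp Require Import all_boot all_order all_algebra.
From mathcomp Require Import all_classical all_reals all_analysis.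
From mathcomp Require Import complex.
Import Order.TTheory GRing.Theory Num.Theory numFieldNormedType.Exports.

Set Implicit Arguments.
Unset Strict Implicit.
Unset Printing Implicit Defensive.

Local Open Scope classical_set_scope.
Local Open Scope ring_scope.

(* The complex numbers are R[i]; its topology and its normed-module structure
   are carried by the alias R[i]^o.  A function on the open unit disc is a total
   map R[i] -> R[i] of which only the values on the disc matter. *)

Definition disc (R : realType) : set R[i] := [set z | `|z| < 1].

Definition eq_on_disc (R : realType) (f g : R[i] -> R[i]) : Prop :=
  forall z, disc z -> f z = g z.

(* Norms over R[i] take their values in R[i], where they are real. *)
Definition rnorm (R : realType) (V : normedModType R[i]) (x : V) : R :=
  complex.Re `|x|.

Definition cnorm (R : realType) (z : R[i]) : R := @rnorm R R[i]^o z.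

Definition analytic (R : realType) (f : R[i] -> R[i]) : Prop :=
  exists a : nat -> R[i], forall z, disc z ->
    series (fun n => a n * z ^+ n : R[i]^o) @ \oo --> (f z : R[i]^o).

(* The circle is parametrized by t in [0, 1], so that Lebesgue measure on
   [0, 1] is normalized arc length; the double point t = 0, 1 is negligible.
   A function on the circle is represented by a function of t. *)
Definition circ (R : realType) (t : R) : R[i] :=
  (cos (2 * pi * t) +i* sin (2 * pi * t))%C.

Definition sqint (R : realType) (g : R -> R[i]) : \bar R :=
  (\int[lebesgue_measure]_(t in `[0%R, 1%R]) (cnorm (g t) ^+ 2)%:E)%E.

Definition L2_circle (R : realType) : set (R -> R[i]) :=
  [set g | [/\ measurable_fun `[0 : R, 1] (fun t : R => complex.Re (g t)),
               measurable_fun `[0 : R, 1] (fun t : R => complex.Im (g t))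
             & (sqint g < +oo)%E]].

Definition H2norm (R : realType) (f : R[i] -> R[i]) : \bar R :=
  (ereal_sup [set sqint (fun t => f (r%:C%C * circ t)%R)
             | r in [set r : R | (0 <= r < 1)%R]] `^ 2^-1)%E.

Definition H2 (R : realType) : set (R[i] -> R[i]) :=
  [set f | analytic f /\ (H2norm f < +oo)%E].

Definition H2_0 (R : realType) : set (R[i] -> R[i]) :=
  [set f | H2 f /\ f 0 = 0].

(* g is the boundary function of f in L^2 of the circle, i.e. the L^2 limit of
   the functions zeta |-> f (r zeta) as r tends to 1 from below. *)
Definition boundary_function (R : realType) (f : R[i] -> R[i]) (g : R -> R[i])
    : Prop :=
  L2_circle g /\
  sqint (fun t => f (r%:C%C * circ t) - g t) @[r --> (1 : R)^'-] --> 0%E.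

Definition inner_function (R : realType) (theta : R[i] -> R[i]) : Prop :=
  [/\ analytic theta,
      exists M : R, forall z, disc z -> cnorm (theta z) <= M
    & exists2 b, boundary_function theta b
      & {ae lebesgue_measure, forall t : R, t \in `[0, 1] -> cnorm (b t) = 1}].

Definition mul_H2 (R : realType) (theta : R[i] -> R[i]) : set (R[i] -> R[i]) :=
  [set f | exists2 h, H2 h & eq_on_disc f (fun z => theta z * h z)].

Definition model_space (R : realType) (theta : R[i] -> R[i])
    : set (R[i] -> R[i]) :=
  [set f | H2 f /\ exists2 h, H2_0 h &
    exists fb thetab hb : R -> R[i],
      [/\ boundary_function f fb, boundary_function theta thetab,
          boundary_function h hb
        & {ae lebesgue_measure, forall t : R, t \in `[0, 1] ->
             fb t = thetab t * conjc (hb t)}]].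

(* A Banach space of analytic functions is a complex Banach space X with a map
   ev : X -> R[i] -> R[i] sending an element of X to the function it is. *)

(* The element of X that is the n-th monomial (0 if there is none). *)
Definition monomial (R : realType) (X : completeNormedModType R[i])
    (ev : X -> R[i] -> R[i]) (n : nat) : X :=
  xget 0 [set x | eq_on_disc (ev x) (fun z => z ^+ n)].

Record standing_assumptions (R : realType) (X : completeNormedModType R[i])
    (ev : X -> R[i] -> R[i]) : Prop := StandingAssumptions {
  sa_linear : forall (a : R[i]) (x y : X),
    eq_on_disc (ev (a *: x + y)) (fun z => a * ev x z + ev y z) ;
  sa_injective : forall x y : X, eq_on_disc (ev x) (ev y) -> x = y ;
  sa_analytic : forall x : X, analytic (ev x) ;
  sa_polynomials : forall p : {poly R[i]},
    exists x : X, eq_on_disc (ev x) (horner p) ;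
  sa_polynomials_dense :
    dense [set x : X | exists p : {poly R[i]}, eq_on_disc (ev x) (horner p)] ;
  sa_monomials :
    (limn_esup (fun n => (rnorm (monomial ev n) `^ n%:R^-1)%:E) <= 1)%E ;
  sa_embedding : exists c : R, forall x : X,
    H2 (ev x) /\ (H2norm (ev x) <= (c * rnorm x)%:E)%E ;
  sa_dilations : forall x : X, exists d : R -> X,
    (forall r : R, 0 < r < 1 ->
       eq_on_disc (ev (d r)) (fun z => ev x (r%:C%C * z))) /\
    d r @[r --> (1 : R)^'-] --> x
}.

(* The topology of pointwise convergence on the ambient type induces the
   weak-star topology on the dual. *)
Definition dual (R : realType) (X : completeNormedModType R[i])
    : set {ptws X -> R[i]^o} :=
  [set L | exists2 l : {linear X -> R[i]^o}, continuous l & L = (l : X -> R[i]^o)].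

Definition cauchy_transform (R : realType) (X : completeNormedModType R[i])
    (ev : X -> R[i] -> R[i]) (L : X -> R[i]^o) : R[i] -> R[i] :=
  fun z => lim (series (fun n => conjc (L (monomial ev n)) * z ^+ n : R[i]^o)
                @ \oo).

(* The weak-star closure in X' (the image of the dual under cauchy_transform) of
   a set A of functions contained in X'. *)
Definition weak_star_closure (R : realType) (X : completeNormedModType R[i])
    (ev : X -> R[i] -> R[i]) (A : set (R[i] -> R[i])) : set (R[i] -> R[i]) :=
  [set g | exists L : {ptws X -> R[i]^o},
    [/\ dual L, eq_on_disc g (cauchy_transform ev L)
      & closure [set L' : {ptws X -> R[i]^o} | dual L' /\
          exists2 f, A f & eq_on_disc f (cauchy_transform ev L')] L]].

Definition poly_multiples (R : realType) (theta : R[i] -> R[i])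
    : set (R[i] -> R[i]) :=
  [set f | exists q : {poly R[i]}, eq_on_disc f (fun z => theta z * q.[z])].

Definition P_property (R : realType) (X : completeNormedModType R[i])
    (ev : X -> R[i] -> R[i]) (theta : R[i] -> R[i]) : Prop :=
  weak_star_closure ev (poly_multiples theta) `&` @H2 R `<=` mul_H2 theta.

Definition dense_in_model_space (R : realType) (X : completeNormedModType R[i])
    (ev : X -> R[i] -> R[i]) (theta : R[i] -> R[i]) : Prop :=
  forall f, model_space theta f -> forall e : R, 0 < e ->
    exists x : X, model_space theta (ev x) /\
      (H2norm (fun z => f z - ev x z)%R < e%:E)%E.

(* Main.v *)
Require Import Defs.
From HB Require Import structures.
From mathcomp Require Import all_boot all_order all_algebra.
From mathcomp Require Import all_classical all_reals all_analysis.
From mathcomp Require Import measurable_realfun complex.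
From mathcomp Require Import ring lra.
Import Order.TTheory GRing.Theory Num.Theory numFieldNormedType.Exports.

Set Implicit Arguments.
Unset Strict Implicit.
Unset Printing Implicit Defensive.

Local Open Scope classical_set_scope.
Local Open Scope ring_scope.

(** The P-property and the density of [X] in the model space both speak about
    orthogonality in [L2] of the circle, once every space in sight is described
    there.

    A function of the Hardy space is the same thing as its boundary function, an
    [L2] limit [b] of analytic polynomials on the circle ([hardy b]).  The
    function on the disc is recovered as [ext b], the power series whose
    coefficients are the Fourier coefficients of [b], with the same norm
    ([H2_hardy], [hardy_boundary], [H2norm_ext], [boundary_unique]).  With [tb]
    the boundary function of [theta], multiplication by [tb] is an isometry
    [W] of [L2], because the modulus of [tb] is one, and it becomes
    multiplication by [theta] on the disc ([ip_W], [ext_W]).  The model space is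
    the orthogonal complement of [theta] times the Hardy space: when [b] is
    orthogonal to all [theta z^n], the function [conj b * tb] has no negative
    frequency and mean zero, so it is the boundary function of the companion
    which the definition of the model space asks for ([hardy_companion],
    [model_space_ext], [model_space_coinvariant]).

    A function [g] of the Hardy space induces the functional [x |-> <x, g>] on
    [X].  Its Cauchy transform is [ext g], and no other functional has that
    Cauchy transform, since polynomials are dense in [X]
    ([cauchy_transform_pairing], [dual_pairing_eq]).  The weak-star closure of a
    subspace of the dual is its bipolar; for [theta] times the polynomials, the
    common kernel in [X] is the set of elements of [X] lying in the model space.
    So a function [g] of the Hardy space lies in the weak-star closure if and
    only if it is orthogonal to that set ([weak_star_closure_ext],
    [weak_star_closure_ip]), whereas it lies in [theta] times the Hardy space if
    and only if it is orthogonal to the whole model space.  The theorem compares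
    these two conditions.

    If the elements of [X] are dense in the model space, write [g = F + W h]
    with [F] in the model space ([model_decomposition]).  Then [F] is orthogonal
    to [g], by density, and to [W h], hence to itself, and [g = W h].

    Conversely, let [F] be in the model space and let [m] be its projection to
    the closure of the elements of [X] in the model space.  Then [F - m] is
    orthogonal to these elements, so the P-property puts it in [theta] times the
    Hardy space.  It is also in the model space, hence orthogonal to itself, and
    [F = m] is a limit of elements of [X]. *)

(** * Complex modulus and conjugation *)

Section ComplexModulus.
Variable R : realType.
Implicit Types z w : R[i].

Lemma cnormE z : cnorm z = Normc.normc z.
Proof. by case: z => a b; rewrite /cnorm /rnorm normc_def. Qed.

Lemma cnorm_sqr z : cnorm z ^+ 2 = complex.Re z ^+ 2 + complex.Im z ^+ 2.
Proof. by case: z => a b; rewrite cnormE sqr_sqrtr// addr_ge0 ?sqr_ge0. Qed.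

Lemma cnorm_ge0 z : 0 <= cnorm z.
Proof. by case: z => a b; rewrite cnormE sqrtr_ge0. Qed.

Lemma cnormM z w : cnorm (z * w) = cnorm z * cnorm w.
Proof. by rewrite !cnormE Normc.normcM. Qed.

Lemma cnormD z w : cnorm (z + w) <= cnorm z + cnorm w.
Proof. by rewrite !cnormE; exact: le_normcD. Qed.

Lemma cnormN z : cnorm (- z) = cnorm z.
Proof. by rewrite !cnormE; exact: normcN. Qed.

Lemma cnormB z w : cnorm (z - w) <= cnorm z + cnorm w.
Proof. by rewrite (le_trans (cnormD _ _))// cnormN. Qed.

Lemma cnorm_distrC z w : cnorm (z - w) = cnorm (w - z).
Proof. by rewrite -cnormN opprB. Qed.

Lemma cnormJ z : cnorm (conjc z) = cnorm z.
Proof. by rewrite !cnormE; case: z => a b /=; rewrite sqrrN. Qed.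

Lemma cnormR (a : R) : cnorm a%:C%C = `|a|.
Proof. by rewrite cnormE /= expr0n addr0 sqrtr_sqr. Qed.

Lemma cnorm0 : cnorm (0 : R[i]) = 0.
Proof. by rewrite (cnormR 0) normr0. Qed.

Lemma cnorm1 : cnorm (1 : R[i]) = 1.
Proof. by rewrite (cnormR 1) normr1. Qed.

Lemma cnormX z n : cnorm (z ^+ n) = cnorm z ^+ n.
Proof. by elim: n => [|n IH]; rewrite ?cnorm1// !exprS cnormM IH. Qed.

Lemma cnorm0_eq0 z : cnorm z = 0 -> z = 0.
Proof. by rewrite cnormE => /Normc.eq0_normc. Qed.

Lemma ler_Re_cnorm z : `|complex.Re z| <= cnorm z.
Proof.
by case: z => a b; rewrite cnormE -sqrtr_sqr ler_wsqrtr// lerDl sqr_ge0.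
Qed.

Lemma ler_Im_cnorm z : `|complex.Im z| <= cnorm z.
Proof.
by case: z => a b; rewrite cnormE -sqrtr_sqr ler_wsqrtr// lerDr sqr_ge0.
Qed.

Lemma cnorm_leD z : cnorm z <= `|complex.Re z| + `|complex.Im z|.
Proof.
have i1 : cnorm ('i%C : R[i]) = 1 by rewrite cnormE /= expr0n add0r expr1n sqrtr1.
rewrite [in leLHS](complexE z) (le_trans (cnormD _ _))// cnormM i1 mul1r.
by rewrite !cnormR.
Qed.

Lemma conjcD z w : conjc (z + w) = conjc z + conjc w.
Proof.
by case: z w => a b [c d]; apply/eqP; rewrite eq_complex /= opprD !eqxx.
Qed.

Lemma conjcN z : conjc (- z) = - conjc z.
Proof. by case: z => a b; apply/eqP; rewrite eq_complex /= !eqxx. Qed.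

Lemma conjcB z w : conjc (z - w) = conjc z - conjc w.
Proof. by rewrite conjcD conjcN. Qed.

Lemma conjcM z w : conjc (z * w) = conjc z * conjc w.
Proof.
case: z w => a b [c d]; apply/eqP.
by rewrite eq_complex /= mulrNN opprD mulrN mulNr !eqxx.
Qed.

Lemma conjcX z n : conjc (z ^+ n) = conjc z ^+ n.
Proof. by elim: n => [|n IH]; rewrite ?conjc1// !exprS conjcM IH. Qed.

Lemma conjc_sum (I : Type) (r : seq I) (F : I -> R[i]) :
  conjc (\sum_(i <- r) F i) = \sum_(i <- r) conjc (F i).
Proof.
by elim: r => [|i r IH]; rewrite ?big_nil ?conjc0// !big_cons conjcD IH.
Qed.

Lemma mulcJ z : z * conjc z = (cnorm z ^+ 2)%:C%C.
Proof.
by rewrite cnorm_sqr; case: z => a b; simpc; rewrite [b * a]mulrC addNr !expr2.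
Qed.

Lemma mulJc z : conjc z * z = (cnorm z ^+ 2)%:C%C.
Proof. by rewrite mulrC mulcJ. Qed.

Lemma cnorm_sum (I : Type) (r : seq I) (P : pred I) (F : I -> R[i]) :
  cnorm (\sum_(i <- r | P i) F i) <= \sum_(i <- r | P i) cnorm (F i).
Proof.
elim/big_ind2: _ => //; first by rewrite cnorm0.
by move=> a b c d ab cd; rewrite (le_trans (cnormD _ _)) ?lerD.
Qed.

Lemma cnorm_ltC (z : R[i]^o) (e : R) : (`|z| < e%:C%C) = (cnorm z < e).
Proof.
have i0 : complex.Im `|z| = 0 by exact: (congr1 (@complex.Im R) (normc_def z)).
rewrite ltcE; transitivity (true && (cnorm z < e)) => //.
by congr (_ && _); exact/eqP/esym.
Qed.

(** The norm of [R[i]] takes its values in [R[i]]; this trades it for real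
    epsilons. *)
Lemma ccvgP (T : Type) (F : set_system T) (FF : Filter F) (u : T -> R[i]^o)
    (l : R[i]^o) :
  u @ F --> l <-> forall e : R, 0 < e -> \forall n \near F, cnorm (u n - l) < e.
Proof.
split=> [/cvgrPdist_lt ul e e0|ul].
  have := ul e%:C%C; rewrite ltcR => /(_ e0); apply: filterS => n.
  by rewrite cnorm_ltC cnorm_distrC.
apply/cvgrPdist_lt => -[e1 e2]; rewrite ltcE/= => /andP[/eqP-> e0].
by apply: filterS (ul _ e0) => n; rewrite cnorm_ltC cnorm_distrC.
Qed.

End ComplexModulus.

(** * Semi-inner products *)

Fact nrm_key : unit. Proof. exact: tt. Qed.

Section SemiInnerProduct.
Variables (R : realType) (V : lmodType R[i]) (ip : V -> V -> R[i]).

Record semi_inner : Prop := SemiInner {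
  ip_linear : forall a x y z, ip (a *: x + y) z = a * ip x z + ip y z ;
  ip_conj : forall x y, ip y x = conjc (ip x y) ;
  ip_ge0 : forall x, 0 <= complex.Re (ip x x)
}.

(** Locked, as are the operations on [L2] below, so that unification never
    compares two values by unfolding them to integrals. *)
Definition nrm : V -> R :=
  locked_with nrm_key (fun x => Num.sqrt (complex.Re (ip x x))).

Lemma nrmE x : nrm x = Num.sqrt (complex.Re (ip x x)).
Proof. by rewrite /nrm locked_withE. Qed.

Hypothesis H : semi_inner.
Implicit Types x y z : V.

Lemma ip0l z : ip 0 z = 0.
Proof.
have := ip_linear H 1 0 0 z; rewrite scale1r addr0 mul1r => /eqP.
by rewrite -subr_eq0 opprD addrA subrr add0r oppr_eq0 => /eqP.
Qed.

Lemma ipDl x y z : ip (x + y) z = ip x z + ip y z.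
Proof. by rewrite -[x]scale1r (ip_linear H) mul1r scale1r. Qed.

Lemma ipZl a x z : ip (a *: x) z = a * ip x z.
Proof. by rewrite -[a *: x]addr0 (ip_linear H) ip0l addr0. Qed.

Lemma ipNl x z : ip (- x) z = - ip x z.
Proof. by rewrite -scaleN1r ipZl mulN1r. Qed.

Lemma ipBl x y z : ip (x - y) z = ip x z - ip y z.
Proof. by rewrite ipDl ipNl. Qed.

Lemma ip0r z : ip z 0 = 0.
Proof. by rewrite (ip_conj H) ip0l conjc0. Qed.

Lemma ipDr x y z : ip x (y + z) = ip x y + ip x z.
Proof. by rewrite (ip_conj H) ipDl conjcD -!(ip_conj H). Qed.

Lemma ipZr a x z : ip x (a *: z) = conjc a * ip x z.
Proof. by rewrite (ip_conj H) ipZl conjcM -(ip_conj H). Qed.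

Lemma ipNr x z : ip x (- z) = - ip x z.
Proof. by rewrite (ip_conj H) ipNl conjcN -(ip_conj H). Qed.

Lemma ipBr x y z : ip x (y - z) = ip x y - ip x z.
Proof. by rewrite ipDr ipNr. Qed.

Lemma ip_suml (I : Type) (r : seq I) (F : I -> V) z :
  ip (\sum_(i <- r) F i) z = \sum_(i <- r) ip (F i) z.
Proof.
elim: r => [|i r IH]; first by rewrite !big_nil ip0l.
by rewrite !big_cons ipDl IH.
Qed.

Lemma nrm_ge0 x : 0 <= nrm x.
Proof. by rewrite nrmE sqrtr_ge0. Qed.
Hint Resolve nrm_ge0 : core.

Lemma nrm_sqr x : nrm x ^+ 2 = complex.Re (ip x x).
Proof. by rewrite nrmE sqr_sqrtr// (ip_ge0 H). Qed.

Lemma ipxx x : ip x x = (nrm x ^+ 2)%:C%C.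
Proof.
rewrite nrm_sqr; have := ip_conj H x x.
case: (ip x x) => a b /= [] /eqP; rewrite -subr_eq0 opprK -mulr2n.
by rewrite mulrn_eq0 /= => /eqP->.
Qed.

Lemma nrm0 : nrm 0 = 0.
Proof. by rewrite nrmE ip0l sqrtr0. Qed.

Lemma nrmZ a x : nrm (a *: x) = cnorm a * nrm x.
Proof.
rewrite -[RHS]ger0_norm ?mulr_ge0 ?cnorm_ge0// -sqrtr_sqr nrmE; congr Num.sqrt.
rewrite ipZl ipZr mulrA mulcJ ipxx -rmorphM /=.
by rewrite exprMn.
Qed.

Lemma nrmN x : nrm (- x) = nrm x.
Proof. by rewrite -scaleN1r nrmZ cnormN cnorm1 mul1r. Qed.

Lemma nrm_distrC x y : nrm (x - y) = nrm (y - x).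
Proof. by rewrite -nrmN opprB. Qed.

Lemma nrmD_sqr x y :
  nrm (x + y) ^+ 2 = nrm x ^+ 2 + nrm y ^+ 2 + 2 * complex.Re (ip x y).
Proof.
rewrite !nrm_sqr ipDl !ipDr (ip_conj H x y).
case: (ip x x) (ip y y) (ip x y) => [a b] [c d] [e f] /=; ring.
Qed.

Lemma nrmB_sqr x y :
  nrm (x - y) ^+ 2 = nrm x ^+ 2 + nrm y ^+ 2 - 2 * complex.Re (ip x y).
Proof.
rewrite nrmD_sqr nrmN ipNr; case: (ip x y) => a b /=; ring.
Qed.

Lemma pythagoras x y : ip x y = 0 ->
  nrm (x + y) ^+ 2 = nrm x ^+ 2 + nrm y ^+ 2.
Proof. by move=> xy; rewrite nrmD_sqr xy mulr0 addr0. Qed.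

Lemma parallelogram x y :
  nrm (x + y) ^+ 2 + nrm (x - y) ^+ 2 = 2 * nrm x ^+ 2 + 2 * nrm y ^+ 2.
Proof. rewrite nrmD_sqr nrmB_sqr; ring. Qed.

Lemma nrm_sub_proj (t : R) x y :
  nrm (x - (t%:C%C * ip x y) *: y) ^+ 2 =
  nrm x ^+ 2 - 2 * t * cnorm (ip x y) ^+ 2
    + t ^+ 2 * cnorm (ip x y) ^+ 2 * nrm y ^+ 2.
Proof.
rewrite nrmB_sqr nrmZ cnormM cnormR ipZr conjcM conjc_real -[_ * _ * ip x y]mulrA mulJc.
rewrite !exprMn real_normK ?num_real// -rmorphM /=; ring.
Qed.

(** The squared norm of [x - (t * ip x y) *: y] is a nonnegative quadratic
    polynomial in [t]; its minimum gives the inequality. *)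
Lemma cauchy_schwarz x y : cnorm (ip x y) <= nrm x * nrm y.
Proof.
rewrite -(@ler_pXn2r _ 2) ?nnegrE ?mulr_ge0 ?cnorm_ge0// exprMn.
have key t : 0 <= nrm x ^+ 2 - 2 * t * cnorm (ip x y) ^+ 2
    + t ^+ 2 * cnorm (ip x y) ^+ 2 * nrm y ^+ 2.
  by rewrite -nrm_sub_proj sqr_ge0.
set A := cnorm _ ^+ 2 in key *; set X := nrm x ^+ 2 in key *.
set Y := nrm y ^+ 2 in key *.
have [X0 Y0 A0] : [/\ 0 <= X, 0 <= Y & 0 <= A] by rewrite !sqr_ge0.
have [Y_eq0|Y_neq0] := eqVneq Y 0.
  rewrite Y_eq0 mulr0 leNgt; apply/negP => A_gt0.
  (* If y is null the polynomial is affine and nonnegative, hence constant. *)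
  have := key ((X + 1) / A); rewrite Y_eq0 mulr0 addr0 -mulrA mulfVK ?gt_eqF//.
  by apply/negP; rewrite -ltNge; lra.
have Y_gt0 : 0 < Y by rewrite lt_def Y_neq0.
have := key Y^-1.
have -> : X - 2 * Y^-1 * A + Y^-1 ^+ 2 * A * Y = X - A / Y by field.
by rewrite subr_ge0 ler_pdivrMr.
Qed.

Lemma nrmD x y : nrm (x + y) <= nrm x + nrm y.
Proof.
rewrite -(@ler_pXn2r _ 2) ?nnegrE ?addr_ge0// nrmD_sqr.
have := le_trans (ler_norm _) (le_trans (ler_Re_cnorm _) (cauchy_schwarz x y)).
by move=> h; rewrite sqrrD; lra.
Qed.

Lemma nrmB_le x y z : nrm (x - z) <= nrm (x - y) + nrm (y - z).
Proof. by rewrite (le_trans _ (nrmD _ _))// addrA subrK. Qed.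

Lemma nrm_chain2 x y z d :
  nrm (x - y) < d / 2 -> nrm (y - z) < d / 2 -> nrm (x - z) < d.
Proof. by move=> ? ?; have := nrmB_le x y z; lra. Qed.

Lemma nrm_chain3 w x y z d : nrm (w - x) < d / 3 -> nrm (x - y) < d / 3 ->
  nrm (y - z) < d / 3 -> nrm (w - z) < d.
Proof. by move=> ? ? ?; have := nrmB_le w x z; have := nrmB_le x y z; lra. Qed.

Lemma nrm_le_dist x y : nrm x <= nrm (x - y) + nrm y.
Proof. by rewrite (le_trans _ (nrmD _ _))// subrK. Qed.

(** The form is only semidefinite, so null vectors replace equalities: functions
    on the circle are not identified when they agree almost everywhere. *)
Lemma ip_null_r x y : nrm y = 0 -> ip x y = 0.
Proof.
move=> y0; apply: cnorm0_eq0; apply/eqP; rewrite eq_le cnorm_ge0 andbT.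
by rewrite (le_trans (cauchy_schwarz _ _))// y0 mulr0.
Qed.

Lemma ip_null_l x y : nrm x = 0 -> ip x y = 0.
Proof. by move=> x0; rewrite (ip_conj H) ip_null_r// conjc0. Qed.

Lemma nrm_eq0 x : (forall e, 0 < e -> nrm x < e) -> nrm x = 0.
Proof.
move=> xe; apply/eqP; rewrite eq_le nrm_ge0 andbT.
by apply/ler_addgt0Pl => e /xe /ltW; rewrite addr0.
Qed.

Lemma ip_eq0_closure x y :
  (forall e, 0 < e -> exists2 z, ip z y = 0 & nrm (x - z) < e) -> ip x y = 0.
Proof.
move=> xe; apply: cnorm0_eq0; apply/eqP; rewrite eq_le cnorm_ge0 andbT.
apply/ler_addgt0Pl => e e0; rewrite addr0.
have [z zy xz] := xe (e / (nrm y + 1)) (divr_gt0 e0 (ltr_wpDl (nrm_ge0 y) ltr01)).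
rewrite -[ip x y]subr0 -zy -ipBl (le_trans (cauchy_schwarz _ _))//.
rewrite (le_trans (ler_wpM2r (nrm_ge0 _) (ltW xz)))// -mulrA ler_piMr ?(ltW e0)//.
by rewrite mulrC ler_pdivrMr ?ltr_wpDl// mul1r lerDl.
Qed.

Section Orthonormal.
Variables (I : eqType) (e : I -> V).
Hypothesis e_on : forall i j, ip (e i) (e j) = (i == j)%:R.

Lemma ip_sum_orthonormal (r : seq I) (c : I -> R[i]) j : uniq r ->
  ip (\sum_(i <- r) c i *: e i) (e j) = if j \in r then c j else 0.
Proof.
move=> r_uniq; rewrite ip_suml; case: ifPn => jr.
  rewrite (bigD1_seq j)//= ipZl e_on eqxx mulr1 big1 ?addr0// => i ij.
  by rewrite ipZl e_on (negbTE ij) mulr0.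
rewrite big_seq big1// => i ir; rewrite ipZl e_on.
by case: eqVneq => [ij|]; rewrite ?mulr0//; rewrite -ij ir in jr.
Qed.

Lemma nrm_sum_orthonormal (r : seq I) (c : I -> R[i]) : uniq r ->
  nrm (\sum_(i <- r) c i *: e i) ^+ 2 = \sum_(i <- r) cnorm (c i) ^+ 2.
Proof.
elim: r => [|i r IH]; first by rewrite !big_nil nrm0 expr0n.
move=> /= /andP[ir r_uniq]; rewrite !big_cons addrC pythagoras ?IH//.
  have /eqP := ipxx (e i); rewrite e_on eqxx nrmZ exprMn => /eqP[] <-.
  by rewrite mulr1 addrC.
by rewrite ipZr ip_sum_orthonormal// (negbTE ir) mulr0.
Qed.

Lemma bessel (r : seq I) x : uniq r ->
  \sum_(i <- r) cnorm (ip x (e i)) ^+ 2 <= nrm x ^+ 2.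
Proof.
move=> r_uniq; pose y := \sum_(i <- r) ip x (e i) *: e i.
have := sqr_ge0 (nrm (x - y)); rewrite nrmB_sqr nrm_sum_orthonormal//.
suff -> : ip x y = (\sum_(i <- r) cnorm (ip x (e i)) ^+ 2)%:C%C by move=> /=; lra.
rewrite (ip_conj H) ip_suml conjc_sum rmorph_sum; apply: eq_bigr => i _.
by rewrite ipZl conjcM -(ip_conj H (e i) x) mulJc.
Qed.

End Orthonormal.

End SemiInnerProduct.
#[global] Hint Resolve nrm_ge0 : core.

(** * Riesz-Fischer and orthogonal projection *)

Section Completeness.
Variables (R : realType) (V : lmodType R[i]) (ip : V -> V -> R[i]).
Hypothesis H : semi_inner ip.
Local Notation nrm := (nrm ip).

Definition nrm_complete : Prop := forall u : nat -> V,
  (forall e, 0 < e -> exists N, forall m n, (N <= m)%N -> (N <= n)%N ->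
     nrm (u m - u n) < e) ->
  exists x, forall e, 0 < e -> exists N, forall n, (N <= n)%N ->
     nrm (u n - x) < e.

Hypothesis C : nrm_complete.

(** The partial sums are Cauchy because their squared distances are differences
    of the bounded increasing sums of squares. *)
Lemma orthonormal_series_cvg (e : nat -> V) (a : nat -> R[i]) (M : R) :
  (forall i j, ip (e i) (e j) = (i == j)%:R) ->
  (forall N, \sum_(n < N) cnorm (a n) ^+ 2 <= M) ->
  exists x, (forall n, ip x (e n) = a n) /\
    forall d, 0 < d -> exists N, nrm (x - \sum_(n < N) a n *: e n) < d.
Proof.
move=> e_on aM; pose s N := \sum_(n < N) a n *: e n.
pose t N : R := \sum_(n < N) cnorm (a n) ^+ 2.
have st m n : (m <= n)%N -> nrm (s n - s m) ^+ 2 = t n - t m.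
  move=> mn; rewrite /s /t -!(big_mkord xpredT (fun n => a n *: e n)).
  rewrite -!(big_mkord xpredT (fun n => cnorm (a n) ^+ 2)).
  rewrite (@big_cat_nat _ _ _ m 0 n)//= addrAC subrr add0r.
  rewrite [in RHS](@big_cat_nat _ _ _ m 0 n)//= [in RHS]addrAC subrr add0r.
  by rewrite (nrm_sum_orthonormal H e_on) ?iota_uniq.
have [t_nd tM] : nondecreasing_seq t /\ has_ubound (range t).
  split; last by exists M => _ [n _ <-]; exact: aM.
  by move=> m n mn; rewrite -subr_ge0 -st// sqr_ge0.
have t_cvg := nondecreasing_cvgn t_nd tM.
have [u uP] : exists x, forall d, 0 < d -> exists N, forall n, (N <= n)%N ->
     nrm (s n - x) < d.
  apply: C => d d0.
  have d2 : 0 < d ^+ 2 / 2 by rewrite divr_gt0 ?exprn_gt0.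
  move/cvgrPdist_lt: t_cvg => /(_ _ d2)[N _ tN]; exists N => m n Nm Nn.
  rewrite -(@ltr_pXn2r _ 2) ?nnegrE ?(ltW d0) ?nrm_ge0//.
  have := tN _ Nm; have := tN _ Nn; rewrite /= !ltr_norml => /andP[? ?] /andP[? ?].
  have [mn|/ltnW nm] := leqP m n.
    by rewrite (nrm_distrC H) st//; lra.
  by rewrite st//; lra.
exists u; split; last first.
  by move=> d /uP[N uN]; exists N; rewrite (nrm_distrC H) uN.
move=> n; apply/eqP; rewrite -subr_eq0.
suff -> : ip u (e n) - a n = 0 by [].
apply: cnorm0_eq0; apply/eqP; rewrite eq_le cnorm_ge0 andbT.
apply/ler_addgt0Pl => d d0; rewrite addr0.
have [N uN] := uP _ d0; set m := maxn N n.+1.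
have -> : ip u (e n) - a n = ip (u - s m) (e n).
  rewrite (ipBl H); congr (_ - _).
  rewrite /s -(big_mkord xpredT (fun n => a n *: e n)).
  rewrite (ip_sum_orthonormal H e_on) ?iota_uniq// mem_index_iota /=.
  by rewrite leq_max ltnSn orbT.
have en1 : nrm (e n) = 1 by rewrite nrmE e_on eqxx sqrtr1.
rewrite (le_trans (cauchy_schwarz H _ _))// en1 mulr1 (nrm_distrC H) ltW//.
by rewrite uN// leq_maxl.
Qed.

(** Orthogonal projection onto the closure of a subspace: a minimizing sequence
    is Cauchy by the parallelogram law. *)
Lemma projection (W : set V) x : W 0 ->
  (forall a y z, W y -> W z -> W (a *: y + z)) ->
  exists2 m, forall w, W w -> ip (x - m) w = 0
    & forall d, 0 < d -> exists2 w, W w & nrm (m - w) < d.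
Proof.
move=> W0 Wlin; pose S := [set nrm (x - w) ^+ 2 | w in W].
have S_lb : has_lbound S by exists 0 => _ [w _ <-]; exact: sqr_ge0.
have S_inf : has_inf S by split=> //; exists (nrm (x - 0) ^+ 2), 0.
have infS w : W w -> inf S <= nrm (x - w) ^+ 2.
  by move=> Ww; apply: ge_inf => //; exists w.
have /choice[w wP] : forall k : nat, exists w,
    W w /\ nrm (x - w) ^+ 2 < inf S + k.+1%:R^-1.
  move=> k; have k0 : 0 < (k.+1%:R : R)^-1 by rewrite invr_gt0.
  by have [_ [w Ww <-] ltw] := inf_adherent k0 S_inf; exists w.
have Wadd y z : W y -> W z -> W (y + z).
  by move=> Wy Wz; rewrite -[y]scale1r; exact: Wlin.
have Wscale a y : W y -> W (a *: y).
  by move=> Wy; rewrite -[a *: y]addr0; exact: Wlin.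
have close i j : nrm (w i - w j) ^+ 2 <= 2 * i.+1%:R^-1 + 2 * j.+1%:R^-1.
  pose p := x - w i; pose q := x - w j.
  have pq : nrm (p + q) ^+ 2 + nrm (p - q) ^+ 2 = 2 * nrm p ^+ 2 + 2 * nrm q ^+ 2.
    exact: parallelogram.
  have -> : w i - w j = - (p - q) by rewrite opprB /p /q opprB [RHS]addrC subrKA.
  rewrite (nrmN H).
  have : 4 * inf S <= nrm (p + q) ^+ 2.
    pose h := (2^-1)%:C%C *: (w i + w j).
    have -> : p + q = 2%:C%C *: (x - h).
      rewrite scalerBr /h scalerA -rmorphM /= divff ?pnatr_eq0// scale1r.
      by rewrite -[2]/(1 + 1) rmorphD /= scalerDl scale1r /p /q opprD addrACA.
    rewrite (nrmZ H) cnormR normr_nat exprMn.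
    suff -> : 2%:R ^+ 2 = 4 :> R.
      by rewrite ler_pM2l ?ltr0n//; apply/infS/Wscale/Wadd; exact: (wP _).1.
    by rewrite -natrX.
  have := (wP i).2; have := (wP j).2; rewrite -/p -/q.
  move: pq (_^-1) (_^-1); move: (nrm _ ^+ 2) (nrm _ ^+ 2) (nrm _ ^+ 2) (nrm _ ^+ 2).
  move=> *; lra.
have [m mP] : exists m, forall d, 0 < d -> exists N, forall n, (N <= n)%N ->
     nrm (w n - m) < d.
  apply: C => d d0.
  have [N _ NP] : \forall n \near \oo, (n.+1%:R : R)^-1 < d ^+ 2 / 4.
    by apply: (near_infty_natSinv_lt (PosNum (_ : 0 < d ^+ 2 / 4)));
       rewrite divr_gt0 ?exprn_gt0.
  exists N => i j Ni Nj; rewrite -(@ltr_pXn2r _ 2) ?nnegrE ?(ltW d0) ?nrm_ge0//.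
  have := close i j; have /= := NP _ Ni; have /= := NP _ Nj.
  by move: (i.+1%:R^-1) (j.+1%:R^-1) => a b *; lra.
have W_m d : 0 < d -> exists2 y, W y & nrm (m - y) < d.
  move=> /mP[N /(_ _ (leqnn N))] Nd; exists (w N); first exact: (wP N).1.
  by rewrite (nrm_distrC H).
exists m => // v Wv.
(* The distance from x is continuous, so the limit m attains the infimum; then
   moving m along v cannot come closer to x, which forces ip (x - m) v = 0. *)
have xm : nrm (x - m) ^+ 2 <= inf S.
  have S0 : 0 <= inf S by apply: lb_le_inf; [exact: S_inf.1|move=> _ [y _ <-]; exact: sqr_ge0].
  rewrite -(sqr_sqrtr S0) ler_pXn2r ?nnegrE ?sqrtr_ge0 ?nrm_ge0//.
  apply/ler_addgt0Pl => d d0.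
  have d20 : 0 < d / 2 by rewrite divr_gt0.
  have [N Nd] := mP _ d20.
  have d40 : 0 < (d / 2) ^+ 2 by rewrite exprn_gt0.
  have [N' _ N'd] := near_infty_natSinv_lt (PosNum d40).
  set k := maxn N N'.
  have wkm : nrm (w k - m) < d / 2 by apply: Nd; rewrite leq_maxl.
  have xwk : nrm (x - w k) <= d / 2 + Num.sqrt (inf S).
    rewrite -(@ler_pXn2r _ 2) ?nnegrE ?addr_ge0 ?sqrtr_ge0 ?nrm_ge0 ?(ltW d20)//.
    rewrite sqrrD (sqr_sqrtr S0); have := (wP k).2.
    have /= := N'd k (leq_maxr _ _); set u := _^-1.
    have : 0 <= d / 2 * Num.sqrt (inf S) by rewrite mulr_ge0 ?sqrtr_ge0 ?(ltW d20).
    by move=> ? ? ?; lra.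
  by have := nrmB_le H x (w k) m; lra.
have mv c : inf S <= nrm (x - m - c *: v) ^+ 2.
  have [S0|S0] := leP (inf S) 0; first by rewrite (le_trans S0)// sqr_ge0.
  rewrite -(sqr_sqrtr (ltW S0)) ler_pXn2r ?nnegrE ?sqrtr_ge0 ?nrm_ge0//.
  apply/ler_addgt0Pl => d /W_m[y Wy my].
  have : Num.sqrt (inf S) <= nrm (x - (y + c *: v)).
    rewrite -(@ler_pXn2r _ 2) ?nnegrE ?sqrtr_ge0 ?nrm_ge0// (sqr_sqrtr (ltW S0)).
    by apply: infS; rewrite addrC; exact: Wlin.
  have -> : x - (y + c *: v) = (x - m - c *: v) + (m - y).
    by rewrite [RHS]addrAC subrKA opprD addrA.
  have := nrmD H (x - m - c *: v) (m - y); lra.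
set A := cnorm (ip (x - m) v) ^+ 2.
suff A0 : A = 0 by apply: cnorm0_eq0; move/eqP: A0; rewrite expf_eq0 /= => /eqP.
apply/eqP; rewrite eq_le sqr_ge0 andbT leNgt; apply/negP => A_gt0.
(* A step t smaller than 2 / nrm v ^ 2 would strictly decrease the distance. *)
pose t := (nrm v ^+ 2 + 1)^-1.
have t0 : 0 < t by rewrite invr_gt0 ltr_wpDl ?sqr_ge0.
have tv : t * nrm v ^+ 2 <= 1.
  by rewrite mulrC ler_pdivrMr ?ltr_wpDl ?sqr_ge0// mul1r lerDl.
have := mv (t%:C%C * ip (x - m) v); rewrite (nrm_sub_proj H) -/A => h.
have : t * A * 2 <= t * A * (t * nrm v ^+ 2) by nra.
by rewrite (ler_pM2l (mulr_gt0 t0 A_gt0)) => /le_trans /(_ tv); rewrite (ler_nat R 2 1).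
Qed.

End Completeness.

(** * Integrals over the circle *)

Section CircleIntegral.
Variable R : realType.
Local Notation mu := (@lebesgue_measure R).
Local Notation D := [set` `[0%R : R, 1%R]].
Implicit Types (f g h : R -> R[i]).

Definition cmeasurable f : Prop :=
  measurable_fun D (fun t => complex.Re (f t)) /\
  measurable_fun D (fun t => complex.Im (f t)).

Lemma L2_circleE f : L2_circle f <-> cmeasurable f /\ (sqint f < +oo)%E.
Proof. by split=> [[? ? ?]|[[]]]. Qed.

Lemma ae_imply (P Q : R -> Prop) : {ae mu, forall t, P t} ->
  (forall t, P t -> Q t) -> {ae mu, forall t, Q t}.
Proof.
move=> [N [mN N0 PN]] PQ; exists N; split => // t nQt; apply: PN => Pt.
by apply: nQt; exact: PQ.
Qed.

Lemma muD : mu D = 1%E.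
Proof. by rewrite lebesgue_measure_itv/= lte_fin ltr01 oppr0 adde0. Qed.

Lemma cmeasurable_cst (c : R[i]) : cmeasurable (fun=> c).
Proof. by split; exact: measurable_cst. Qed.

Lemma cReD (z w : R[i]) : complex.Re (z + w) = complex.Re z + complex.Re w.
Proof. by case: z w => a b [c d]. Qed.

Lemma cImD (z w : R[i]) : complex.Im (z + w) = complex.Im z + complex.Im w.
Proof. by case: z w => a b [c d]. Qed.

Lemma cReM (z w : R[i]) : complex.Re (z * w) =
  complex.Re z * complex.Re w - complex.Im z * complex.Im w.
Proof. by case: z w => a b [c d]. Qed.

Lemma cImM (z w : R[i]) : complex.Im (z * w) =
  complex.Re z * complex.Im w + complex.Im z * complex.Re w.
Proof. by case: z w => a b [c d]. Qed.

Lemma cReJ (z : R[i]) : complex.Re (conjc z) = complex.Re z.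
Proof. by case: z. Qed.

Lemma cImJ (z : R[i]) : complex.Im (conjc z) = - complex.Im z.
Proof. by case: z. Qed.

Lemma cmeasurableD f g : cmeasurable f -> cmeasurable g ->
  cmeasurable (fun t => f t + g t).
Proof.
move=> [f1 f2] [g1 g2]; split.
  by apply: eq_measurable_fun (fun t _ => esym (cReD _ _)) _; exact: measurable_funD.
by apply: eq_measurable_fun (fun t _ => esym (cImD _ _)) _; exact: measurable_funD.
Qed.

Lemma cmeasurableM f g : cmeasurable f -> cmeasurable g ->
  cmeasurable (fun t => f t * g t).
Proof.
move=> [f1 f2] [g1 g2]; split.
  by apply: eq_measurable_fun (fun t _ => esym (cReM _ _)) _;
    apply: measurable_funB; exact: measurable_funM.
by apply: eq_measurable_fun (fun t _ => esym (cImM _ _)) _;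
  apply: measurable_funD; exact: measurable_funM.
Qed.

Lemma cmeasurableJ f : cmeasurable f -> cmeasurable (fun t => conjc (f t)).
Proof.
move=> [f1 f2]; split; first exact: eq_measurable_fun (fun t _ => esym (cReJ _)) f1.
by apply: eq_measurable_fun (fun t _ => esym (cImJ _)) _; exact: measurableT_comp.
Qed.

Lemma cmeasurableZ c f : cmeasurable f -> cmeasurable (fun t => c * f t).
Proof. exact/cmeasurableM/cmeasurable_cst. Qed.

Lemma cmeasurableN f : cmeasurable f -> cmeasurable (fun t => - f t).
Proof.
move=> /(cmeasurableZ (-1)); congr cmeasurable.
by apply/funext => t; rewrite mulN1r.
Qed.

Lemma cmeasurableB f g : cmeasurable f -> cmeasurable g ->
  cmeasurable (fun t => f t - g t).
Proof. by move=> mf mg; apply: cmeasurableD => //; exact: cmeasurableN. Qed.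

Lemma measurable_cnorm_sqr f : cmeasurable f ->
  measurable_fun D (fun t => (cnorm (f t) ^+ 2)%:E).
Proof.
move=> [f1 f2]; apply/measurable_EFinP.
apply: eq_measurable_fun (fun t _ => esym (cnorm_sqr _)) _.
by apply: measurable_funD; exact: measurable_funX.
Qed.

Lemma measurable_cnorm f : cmeasurable f ->
  measurable_fun D (fun t => (cnorm (f t))%:E).
Proof.
move=> /measurable_cnorm_sqr/measurable_EFinP mf; apply/measurable_EFinP.
have -> : (fun t => cnorm (f t)) = (@powR R ^~ 2^-1) \o (fun t => cnorm (f t) ^+ 2).
  apply/funext => t /=; rewrite powR12_sqrt ?sqr_ge0// sqrtr_sqr ger0_norm//.
  exact: cnorm_ge0.
by apply: measurableT_comp => //; exact: measurable_powR.
Qed.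

Lemma cmeasurable_cvg (u : nat -> R -> R[i]) f :
  (forall n, cmeasurable (u n)) ->
  (forall t, D t -> forall e, 0 < e -> \forall n \near \oo, cnorm (u n t - f t) < e) ->
  cmeasurable f.
Proof.
move=> mu_ uf; split.
  apply: (@measurable_fun_cvg _ _ _ _ (fun n t => complex.Re (u n t))) => //.
    by move=> n; case: (mu_ n).
  move=> t Dt; apply/cvgrPdist_lt => e e0; apply: filterS (uf t Dt e e0) => n.
  apply: le_lt_trans; rewrite cnorm_distrC (le_trans _ (ler_Re_cnorm _))//.
  by case: (f t) (u n t) => ? ? [].
apply: (@measurable_fun_cvg _ _ _ _ (fun n t => complex.Im (u n t))) => //.
  by move=> n; case: (mu_ n).
move=> t Dt; apply/cvgrPdist_lt => e e0; apply: filterS (uf t Dt e e0) => n.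
apply: le_lt_trans; rewrite cnorm_distrC (le_trans _ (ler_Im_cnorm _))//.
by case: (f t) (u n t) => ? ? [].
Qed.

Lemma eq_integrable_circle (F G : R -> \bar R) :
  (forall t, D t -> F t = G t) -> mu.-integrable D F -> mu.-integrable D G.
Proof. by move=> FG; apply: eq_integrable => // t /set_mem; exact: FG. Qed.

Lemma integrable_circleD (F G : R -> R) :
  mu.-integrable D (fun t => (F t)%:E) -> mu.-integrable D (fun t => (G t)%:E) ->
  mu.-integrable D (fun t => (F t + G t)%:E).
Proof.
move=> iF iG; apply: eq_integrable_circle (integrableD _ iF iG) => //.
Qed.

Lemma integrable_circleZ (r : R) (F : R -> R) :
  mu.-integrable D (fun t => (F t)%:E) -> mu.-integrable D (fun t => (r * F t)%:E).
Proof.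
by move=> iF; apply: eq_integrable_circle (integrableZl _ r iF).
Qed.

Definition cintegrable f : Prop :=
  mu.-integrable D (fun t => (complex.Re (f t))%:E) /\
  mu.-integrable D (fun t => (complex.Im (f t))%:E).

Definition cint f : R[i] :=
  (\int[mu]_(t in D) complex.Re (f t) +i* \int[mu]_(t in D) complex.Im (f t))%C.

Lemma eq_cint f g : {in D, f =1 g} -> cint f = cint g.
Proof.
move=> fg; congr (_ +i* _)%C; apply: eq_Rintegral => t Dt; by rewrite fg.
Qed.

Lemma cintD f g : cintegrable f -> cintegrable g ->
  cint (fun t => f t + g t) = cint f + cint g.
Proof.
move=> [f1 f2] [g1 g2]; rewrite /cint.
under eq_Rintegral do rewrite cReD.
under [X in (_ +i* X)%C]eq_Rintegral do rewrite cImD.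
by rewrite !RintegralD.
Qed.

Lemma cintegrableZ c f : cintegrable f -> cintegrable (fun t => c * f t).
Proof.
move=> [f1 f2]; split.
  apply: eq_integrable_circle (integrable_circleD
    (integrable_circleZ (complex.Re c) f1) (integrable_circleZ (- complex.Im c) f2)).
  by move=> t _; rewrite cReM mulNr.
apply: eq_integrable_circle (integrable_circleD
  (integrable_circleZ (complex.Re c) f2) (integrable_circleZ (complex.Im c) f1)).
by move=> t _; rewrite cImM.
Qed.

Lemma cintZ c f : cintegrable f -> cint (fun t => c * f t) = c * cint f.
Proof.
case: c => a b [f1 f2]; rewrite /cint.
have Z (r : R) (k : R -> R) : mu.-integrable D (fun t => (k t)%:E) ->
  mu.-integrable D (EFin \o (fun t => r * k t)).
    exact: integrable_circleZ.
under eq_Rintegral do rewrite cReM /=.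
under [X in (_ +i* X)%C]eq_Rintegral do rewrite cImM /=.
rewrite RintegralB ?RintegralD//; try exact: Z.
by rewrite !RintegralZl.
Qed.

Lemma cint_conj f : cintegrable f -> cint (fun t => conjc (f t)) = conjc (cint f).
Proof.
move=> [f1 f2]; rewrite /cint /=; congr (_ +i* _)%C.
  by apply: eq_Rintegral => t _; rewrite cReJ.
rewrite -[RHS]mulN1r -RintegralZl//; apply: eq_Rintegral => t _.
by rewrite cImJ mulN1r.
Qed.

Lemma ae_eq_cint f g : cmeasurable f -> cmeasurable g ->
  {ae mu, forall t, D t -> f t = g t} -> cint f = cint g.
Proof.
move=> [f1 f2] [g1 g2] fg; rewrite /cint /Rintegral; congr (fine _ +i* fine _)%C.
  have fg' : {ae mu, forall t, D t -> (complex.Re (f t))%:E = (complex.Re (g t))%:E}.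
    by refine (ae_imply fg _) => t ft Dt; rewrite ft.
  by apply: ae_eq_integral => //; exact/measurable_EFinP.
have fg' : {ae mu, forall t, D t -> (complex.Im (f t))%:E = (complex.Im (g t))%:E}.
  by refine (ae_imply fg _) => t ft Dt; rewrite ft.
by apply: ae_eq_integral => //; exact/measurable_EFinP.
Qed.

Lemma le_cintegrable f (k : R -> R) : cmeasurable f ->
  mu.-integrable D (fun t => (k t)%:E) -> (forall t, D t -> cnorm (f t) <= k t) ->
  cintegrable f.
Proof.
move=> [f1 f2] ik fk; split; apply: le_integrable ik => //.
- exact/measurable_EFinP.
- move=> t Dt; rewrite lee_fin (le_trans (ler_Re_cnorm _))//.
  by rewrite (le_trans (fk _ Dt))// ler_norm.
- exact/measurable_EFinP.
- move=> t Dt; rewrite lee_fin (le_trans (ler_Im_cnorm _))//.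
  by rewrite (le_trans (fk _ Dt))// ler_norm.
Qed.

Lemma sqint_ge0 f : (0 <= sqint f)%E.
Proof. by apply: integral_ge0 => t _; rewrite lee_fin sqr_ge0. Qed.

Lemma L2_integrable f : L2_circle f ->
  mu.-integrable D (fun t => (cnorm (f t) ^+ 2)%:E).
Proof.
move=> /L2_circleE[mf ff]; apply/integrableP; split.
  exact: measurable_cnorm_sqr.
by under eq_integral do rewrite gee0_abs ?lee_fin ?sqr_ge0//.
Qed.

Lemma L2_prod_integrable f g : L2_circle f -> L2_circle g ->
  cintegrable (fun t => f t * conjc (g t)).
Proof.
move=> Lf Lg; have [mf _] := (L2_circleE f).1 Lf; have [mg _] := (L2_circleE g).1 Lg.
apply: (@le_cintegrable _ (fun t => cnorm (f t) ^+ 2 + cnorm (g t) ^+ 2)).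
- exact/cmeasurableM/cmeasurableJ.
- by apply: integrable_circleD; exact: L2_integrable.
move=> t _; rewrite cnormM cnormJ; have := cnorm_ge0 (f t); have := cnorm_ge0 (g t).
by move: (cnorm _) (cnorm _) => a b a0 b0; nra.
Qed.

Lemma le_sqint f g : cmeasurable f -> cmeasurable g ->
  {ae mu, forall t, D t -> cnorm (f t) <= cnorm (g t)} ->
  (sqint f <= sqint g)%E.
Proof.
move=> mf mg fg; apply: ae_ge0_le_integral => //.
- by move=> t _; rewrite lee_fin sqr_ge0.
- exact: measurable_cnorm_sqr.
- by move=> t _; rewrite lee_fin sqr_ge0.
- exact: measurable_cnorm_sqr.
by refine (ae_imply fg _) => t ft Dt; rewrite lee_fin ler_pXn2r ?nnegrE ?cnorm_ge0 ?ft.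
Qed.

Lemma sqintZ c f : cmeasurable f ->
  sqint (fun t => c * f t) = ((cnorm c ^+ 2)%:E * sqint f)%E.
Proof.
move=> mf; rewrite /sqint; under eq_integral do rewrite cnormM exprMn EFinM.
rewrite ge0_integralZl_EFin ?sqr_ge0//; first by move=> t _; rewrite lee_fin sqr_ge0.
exact: measurable_cnorm_sqr.
Qed.

Lemma sqintD f g : cmeasurable f -> cmeasurable g ->
  (sqint (fun t => f t + g t)%R <= 2%:E * sqint f + 2%:E * sqint g)%E.
Proof.
move=> mf mg; rewrite /sqint.
have p k : cmeasurable k ->
  (2%:E * \int[mu]_(t in D) (cnorm (k t) ^+ 2)%:E =
   \int[mu]_(t in D) (2 * cnorm (k t) ^+ 2)%:E)%E.
  move=> mk; under [RHS]eq_integral do rewrite EFinM.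
  rewrite ge0_integralZl_EFin//; first by move=> t _; rewrite lee_fin sqr_ge0.
  exact: measurable_cnorm_sqr.
have m2 k : cmeasurable k -> measurable_fun D (fun t => (2 * cnorm (k t) ^+ 2)%:E).
  move=> /measurable_cnorm_sqr/measurable_EFinP mk; apply/measurable_EFinP.
  exact: measurable_funM.
rewrite !p// -ge0_integralD//; last 4 first.
- by move=> t _; rewrite lee_fin mulr_ge0 ?sqr_ge0.
- exact: m2.
- by move=> t _; rewrite lee_fin mulr_ge0 ?sqr_ge0.
- exact: m2.
apply: ge0_le_integral => //.
- by move=> t _; rewrite lee_fin sqr_ge0.
- exact: (measurable_cnorm_sqr (cmeasurableD mf mg)).
- by apply: emeasurable_funD; exact: m2.
move=> t _; rewrite -EFinD lee_fin.
have := cnormD (f t) (g t); have := cnorm_ge0 (f t + g t).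
move: (cnorm _) (cnorm _) (cnorm _) => a b c c0 cab.
have : c ^+ 2 <= (b + a) ^+ 2 by rewrite ler_pXn2r ?nnegrE// (le_trans c0).
by have := sqr_ge0 (b - a); rewrite sqrrB sqrrD; lra.
Qed.

Lemma L2_cst0 : L2_circle (fun _ : R => 0 : R[i]).
Proof.
apply/L2_circleE; split; first exact: cmeasurable_cst.
by rewrite /sqint; under eq_integral do rewrite cnorm0 expr0n; rewrite integral0 ltry.
Qed.

Lemma L2_linear c f g : L2_circle f -> L2_circle g ->
  L2_circle (fun t => c * f t + g t).
Proof.
move=> /L2_circleE[mf ff] /L2_circleE[mg fg]; apply/L2_circleE; split.
  by apply: cmeasurableD => //; exact: cmeasurableZ.
apply: le_lt_trans (sqintD (cmeasurableZ c mf) mg) _.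
by rewrite sqintZ// lte_add_pinfty// !lte_mul_pinfty// ?lee_fin ?sqr_ge0// sqint_ge0.
Qed.

Lemma L2_mul_bounded (M : R) f g : cmeasurable f ->
  {ae mu, forall t, D t -> cnorm (f t) <= M} ->
  L2_circle g -> L2_circle (fun t => f t * g t).
Proof.
move=> mf fM /L2_circleE[mg fg]; apply/L2_circleE; split; first exact: cmeasurableM.
apply: (@le_lt_trans _ _ (sqint (fun t => M%:C%C * g t))).
  apply: le_sqint; [exact: cmeasurableM|exact: cmeasurableZ|].
  refine (ae_imply fM _) => t ft Dt; rewrite !cnormM ler_wpM2r ?cnorm_ge0//.
  by rewrite cnormR (le_trans (ft Dt))// ler_norm.
by rewrite sqintZ// lte_mul_pinfty// lee_fin sqr_ge0.
Qed.

Lemma L2_conj f : L2_circle f -> L2_circle (fun t => conjc (f t)).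
Proof.
move=> /L2_circleE[mf ff]; apply/L2_circleE; split; first exact: cmeasurableJ.
by rewrite /sqint; under eq_integral do rewrite cnormJ.
Qed.

Lemma L2_bounded (M : R) f : cmeasurable f ->
  {ae mu, forall t, D t -> cnorm (f t) <= M} -> L2_circle f.
Proof.
move=> mf fM; rewrite (_ : f = fun t => f t * 1); last first.
  by apply/funext => t; rewrite mulr1.
apply: L2_mul_bounded mf fM _.
apply/L2_circleE; split; first exact: cmeasurable_cst.
rewrite /sqint; under eq_integral do rewrite cnorm1 expr1n.
by rewrite integral_cst//= muD mule1 ltry.
Qed.

End CircleIntegral.

(** * Completeness of [L2] *)

Section ComplexSeries.
Variable R : realType.
Implicit Types c : nat -> R[i].

Lemma cseries_ReE c n : series (fun k => complex.Re (c k)) n = complex.Re (series (c : nat -> R[i]^o) n).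
Proof. by rewrite /series /=; elim/big_ind2: _ => // x a y b -> ->; rewrite cReD. Qed.

Lemma cseries_ImE c n : series (fun k => complex.Im (c k)) n = complex.Im (series (c : nat -> R[i]^o) n).
Proof. by rewrite /series /=; elim/big_ind2: _ => // x a y b -> ->; rewrite cImD. Qed.

Lemma cseries_abs_cvg c : cvgn (series (fun k => cnorm (c k))) ->
  exists l : R[i]^o, series (c : nat -> R[i]^o) @ \oo --> l.
Proof.
move=> cc.
have re : cvgn (series (fun k => complex.Re (c k))).
  apply: normed_cvg; apply: series_le_cvg cc => n; rewrite ?cnorm_ge0 ?normr_ge0//.
  exact: ler_Re_cnorm.
have im : cvgn (series (fun k => complex.Im (c k))).
  apply: normed_cvg; apply: series_le_cvg cc => n; rewrite ?cnorm_ge0 ?normr_ge0//.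
  exact: ler_Im_cnorm.
set a := lim (series (fun k => complex.Re (c k)) @ \oo) in re.
set b := lim (series (fun k => complex.Im (c k)) @ \oo) in im.
exists (a +i* b)%C; apply/ccvgP => e e0.
have e2 : 0 < e / 2 by rewrite divr_gt0.
move/cvgrPdist_lt: re => /(_ _ e2) re; move/cvgrPdist_lt: im => /(_ _ e2) im.
near=> n; apply: le_lt_trans (cnorm_leD _) _.
rewrite [e]splitr ltrD//.
  have -> : complex.Re (series (c : nat -> R[i]^o) n - (a +i* b)%C) =
      series (fun k => complex.Re (c k)) n - a.
    by rewrite cseries_ReE; case: (series _ n).
  by rewrite distrC; near: n; exact: re.
have -> : complex.Im (series (c : nat -> R[i]^o) n - (a +i* b)%C) =
    series (fun k => complex.Im (c k)) n - b.
  by rewrite cseries_ImE; case: (series _ n).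
by rewrite distrC; near: n; exact: im.
Unshelve. all: by end_near. Qed.

Lemma cnorm_sub_le (z w : R[i]) : cnorm z - cnorm w <= cnorm (z - w).
Proof. by rewrite lerBlDr -[X in cnorm X <= _](subrK w) cnormD. Qed.

Lemma cvg_cnorm (T : Type) (F : set_system T) (FF : Filter F) (u : T -> R[i]^o)
    (l : R[i]^o) : u @ F --> l -> cnorm (u x) @[x --> F] --> cnorm l.
Proof.
move=> /ccvgP ul; apply/cvgrPdist_lt => e e0; apply: filterS (ul _ e0) => x.
apply: le_lt_trans; rewrite ler_norml lerNl opprB cnorm_sub_le.
by rewrite cnorm_distrC cnorm_sub_le.
Qed.

End ComplexSeries.

Fact L2_key : unit. Proof. exact: tt. Qed.

Section L2Type.
Variable R : realType.

Definition L2pred : {pred R -> R[i]^o} := fun f => `[< L2_circle f >].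

Lemma L2pred_submod_closed : submod_closed L2pred.
Proof.
split; first by apply/asboolP; exact: L2_cst0.
by move=> c f g /asboolP Lf /asboolP Lg; apply/asboolP; exact: L2_linear.
Qed.

HB.instance Definition _ :=
  GRing.isSubmodClosed.Build R[i] (R -> R[i]^o) L2pred L2pred_submod_closed.

(** Square integrable functions themselves rather than classes modulo null
    functions, hence only a semi-inner product. *)
Record L2 := MkL2 { L2val :> R -> R[i]^o ; L2_mem : L2pred L2val }.

HB.instance Definition _ := [isSub for L2val].
HB.instance Definition _ := [Choice of L2 by <:].
HB.instance Definition _ := [SubChoice_isSubLmodule of L2 by <:].

Lemma L2P (f : L2) : L2_circle f.
Proof. exact/asboolP/L2_mem. Qed.

(** Total version of the constructor, so that operations on [L2] can be defined
    before their square integrability is known. *)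
Definition toL2 : (R -> R[i]^o) -> L2 := locked_with L2_key (insubd 0).

Lemma toL2E (f : R -> R[i]^o) : L2_circle f -> toL2 f = f :> (R -> R[i]^o).
Proof.
by move=> Lf; rewrite /toL2 locked_withE insubdK//; exact/asboolP.
Qed.

Lemma L2_addE (f g : L2) t : (f + g) t = f t + g t.
Proof. by []. Qed.

Lemma L2_subE (f g : L2) t : (f - g) t = f t - g t.
Proof. by []. Qed.

Lemma L2_scaleE c (f : L2) t : (c *: f) t = c * f t.
Proof. by []. Qed.

Lemma L2_meas (f : L2) : cmeasurable f.
Proof. by have [] := (L2_circleE _).1 (L2P f). Qed.

Definition ip : L2 -> L2 -> R[i] :=
  locked_with L2_key (fun f g => cint (fun t => f t * conjc (g t))).

Lemma ipE (f g : L2) : ip f g = cint (fun t => f t * conjc (g t)).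
Proof. by rewrite /ip locked_withE. Qed.

Lemma ip_self (f : L2) : ip f f = (fine (sqint f))%:C%C.
Proof.
rewrite ipE /cint /Rintegral /sqint; congr (_ +i* _)%C.
  by congr fine; apply: eq_integral => t _; rewrite mulcJ.
by under eq_integral do rewrite mulcJ /=; rewrite integral0.
Qed.

Lemma semi_inner_ip : semi_inner ip.
Proof.
split.
- move=> a x y z; rewrite !ipE -cintZ; last exact/L2_prod_integrable/L2P/L2P.
  rewrite -cintD; [|exact/cintegrableZ/L2_prod_integrable/L2P/L2P
                   |exact/L2_prod_integrable/L2P/L2P].
  by apply: eq_cint => t _; rewrite L2_addE L2_scaleE mulrDl mulrA.
- move=> x y; rewrite !ipE -cint_conj; last exact/L2_prod_integrable/L2P/L2P.
  by apply: eq_cint => t _; rewrite conjcM conjcK mulrC.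
- by move=> x; rewrite ip_self /= fine_ge0// sqint_ge0.
Qed.

Lemma sqintE (f : L2) : sqint f = (nrm ip f ^+ 2)%:E.
Proof.
rewrite (nrm_sqr semi_inner_ip) ip_self /= fineK// ge0_fin_numE ?sqint_ge0//.
by have [] := (L2_circleE _).1 (L2P f).
Qed.

Lemma ae_nrm0 (f g : L2) :
  {ae lebesgue_measure, forall t, [set` `[0%R : R, 1%R]] t -> f t = g t} ->
  nrm ip (f - g) = 0.
Proof.
move=> fg; apply/eqP; rewrite eq_le nrm_ge0 andbT.
have h : (sqint (f - g)%R <= sqint (0%R : L2))%E.
  apply: le_sqint; try exact: L2_meas.
  by refine (ae_imply fg _) => t ft Dt; rewrite L2_subE ft// subrr.
move: h; rewrite !sqintE (nrm0 semi_inner_ip) lee_fin.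
by rewrite ler_pXn2r ?nnegrE ?nrm_ge0.
Qed.

End L2Type.

Section RieszFischer.
Variable R : realType.
Local Notation mu := (@lebesgue_measure R).
Local Notation D := [set` `[0%R : R, 1%R]].
Local Notation nrm := (nrm (@ip R)).
Let H := @semi_inner_ip R.

(** The inequality [|h| <= a |h|^2 + a^-1] bounds the first moment by the second
    one; taking for [a] the inverse of a bound of the [L2] norm makes this
    linear in that bound. *)
Lemma int_cnorm_le (h : L2 R) (a : R) : 0 < a ->
  (\int[mu]_(t in D) (cnorm (h t))%:E <= (a * nrm h ^+ 2 + a^-1)%:E)%E.
Proof.
move=> a0; have a0' : 0 <= a by exact: ltW.
have h1 : (\int[mu]_(t in D) (a%:E * (cnorm (h t) ^+ 2)%:E) = (a * nrm h ^+ 2)%:E)%E.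
  rewrite ge0_integralZl_EFin//; first by rewrite EFinM -sqintE.
    by move=> t _; rewrite lee_fin sqr_ge0.
  exact: (measurable_cnorm_sqr (L2_meas h)).
have m1 : measurable_fun D (fun t => (a%:E * (cnorm (h t) ^+ 2)%:E)%E).
  apply: measurable_funeM; exact: (measurable_cnorm_sqr (L2_meas h)).
have h2 : (\int[mu]_(t in D) (a%:E * (cnorm (h t) ^+ 2)%:E + (a^-1)%:E)
          = (a * nrm h ^+ 2 + a^-1)%:E)%E.
  rewrite ge0_integralD//.
  - by rewrite h1 integral_cst//= muD mule1 EFinD.
  - by move=> t _; rewrite -EFinM lee_fin mulr_ge0 ?sqr_ge0.
  - by move=> t _; rewrite lee_fin invr_ge0.
rewrite -h2; apply: ge0_le_integral => //.
- by move=> t _; rewrite lee_fin cnorm_ge0.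
- exact: (measurable_cnorm (L2_meas h)).
- by apply: emeasurable_funD.
move=> t _; rewrite -EFinM -EFinD lee_fin.
have := cnorm_ge0 (h t); move: (cnorm _) => x x0.
have [ax|/ltW xa] := leP 1 (a * x).
  have : x <= a * x ^+ 2 by rewrite expr2 mulrA ler_peMl.
  by move=> /le_trans; apply; rewrite lerDl invr_ge0.
have : x <= a^-1 by rewrite -(ler_pM2l a0) divff ?gt_eqF.
by move=> /le_trans; apply; rewrite lerDr mulr_ge0 ?sqr_ge0.
Qed.

Lemma limn_einf_le (u : nat -> \bar R) M : (forall n, u n <= M)%E ->
  (limn_einf u <= M)%E.
Proof.
move=> uM; rewrite limn_einf_lim; apply: lime_le; first exact: is_cvg_einfs.
apply: nearW => n; apply: le_trans (uM n).
by apply: ereal_inf_lbound; exists n => /=.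
Qed.

(** A fast Cauchy subsequence converges almost everywhere, because the integral
    of the sum of its increments is finite; Fatou's lemma turns this into norm
    convergence. *)
Theorem L2_complete : nrm_complete (@ip R).
Proof.
move=> u uC.
have /choice[N0 N0P] : forall k : nat, exists N, forall m n, (N <= m)%N ->
    (N <= n)%N -> nrm (u m - u n) < 2^-1 ^+ k.
  by move=> k; apply: uC; rewrite exprn_gt0.
(* The maximum makes the indices of the subsequence monotone. *)
pose N k := (\max_(j < k.+1) N0 j)%N; pose v k := u (N k).
have N_ge j k : (j <= k)%N -> (N0 j <= N k)%N.
  by move=> jk; exact: (@leq_bigmax _ (fun i : 'I_k.+1 => N0 i) (Ordinal (jk : (j < k.+1)%N))).
have vv j k l : (j <= k)%N -> (j <= l)%N -> nrm (v k - v l) < 2^-1 ^+ j.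
  by move=> jk jl; apply: N0P; exact: N_ge.
pose w k t := cnorm (v k.+1 t - v k t).
have mw k : measurable_fun D (fun t => (w k t)%:E).
  exact: (measurable_cnorm (L2_meas (v k.+1 - v k))).
have w_int : mu.-integrable D (fun t => \sum_(0 <= k <oo) (w k t)%:E)%E.
  apply/integrableP; split.
    by apply: ge0_emeasurable_sum => // [k t _ _|k _]; [rewrite lee_fin cnorm_ge0|exact: mw].
  have -> : (\int[mu]_(t in D) `|\sum_(0 <= k <oo) (w k t)%:E| =
      \int[mu]_(t in D) \sum_(0 <= k <oo) (w k t)%:E)%E.
    apply: eq_integral => t _; rewrite gee0_abs// nneseries_ge0// => k _ _.
    by rewrite lee_fin cnorm_ge0.
  rewrite integral_nneseries//; last by move=> k t _; rewrite lee_fin cnorm_ge0.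
  apply: (@le_lt_trans _ _ (\sum_(0 <= k <oo) (4 / (2 ^ (k + 1))%:R)%:E)%E).
    apply: lee_nneseries => k _; first by
      move=> _; apply: integral_ge0 => t _; rewrite lee_fin cnorm_ge0.
    apply: le_trans (int_cnorm_le (v k.+1 - v k) (_ : 0 < 2 ^+ k)) _.
      by rewrite exprn_gt0.
    have -> : 4 / (2 ^ (k + 1))%:R = 2 * (2 ^+ k)^-1 :> R.
      by rewrite addn1 expnS natrM natrX; field; rewrite expf_neq0.
    have := vv k k.+1 k (leqnSn k) (leqnn k); rewrite exprVn lee_fin.
    have : 0 < 2 ^+ k :> R by rewrite exprn_gt0.
    move: (nrm _) (nrm_ge0 (@ip R) (v k.+1 - v k)) (2 ^+ k) => n n0 a a0 na.
    have n2 : n ^+ 2 <= a^-1 ^+ 2 by rewrite ler_pXn2r ?nnegrE// ?invr_ge0 ltW.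
    have : a * n ^+ 2 <= a * a^-1 ^+ 2 by rewrite ler_pM2l.
    have -> : a * a^-1 ^+ 2 = a^-1 by field; rewrite gt_eqF.
    by move: (a^-1) => b ?; lra.
  by rewrite (cvg_lim _ (@cvg_geometric_eseries_half R 4 0))// ltry.
have [Z [mZ Z0 ZP]] : {ae mu, forall t, D t ->
    (\sum_(0 <= k <oo) (w k t)%:E)%E \is a fin_num}.
  by apply: integrable_ae w_int.
have v_cvg t : D t -> ~ Z t -> exists l : R[i]^o, v ^~ t @ \oo --> l.
  move=> Dt nZt.
  have Wt : (\sum_(0 <= k <oo) (w k t)%:E)%E \is a fin_num.
    by apply: contrapT => nf; apply: nZt; apply: ZP => /(_ Dt).
  have cw : cvgn (series (fun k => cnorm ((v k.+1 t - v k t) : R[i]))).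
    apply: nondecreasing_is_cvgn.
      by apply/nondecreasing_series => k _ _; exact: cnorm_ge0.
    exists (fine (\sum_(0 <= k <oo) (w k t)%:E)%E) => _ [n _ <-].
    rewrite -lee_fin fineK// /series /= -sumEFin.
    by apply: nneseries_lim_ge => k _ _; rewrite lee_fin cnorm_ge0.
  have [l vl] := cseries_abs_cvg cw.
  exists (l + v 0%N t); apply/ccvgP => e e0.
  apply: filterS ((ccvgP _ _ _).1 vl e e0) => n.
  rewrite /series /= telescope_sumr//; congr (cnorm _ < e).
  by rewrite opprD addrA addrAC.
(* Setting v k to zero on the null set Z makes it converge everywhere. *)
pose z k (t : R) : R[i]^o := if t \in Z then 0 else v k t.
have mz k : cmeasurable (z k).
  have -> : z k = fun t => (\1_(~` Z) t : R)%:C%C * v k t.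
    apply/funext => t; rewrite /z indicE in_setC.
    by case: (t \in Z) => /=; rewrite ?mul0r ?mul1r.
  apply: cmeasurableM; last exact: L2_meas.
  by split; [exact/measurable_indic/measurableC|exact: measurable_cst].
have /choice[g gP] : forall t, exists l : R[i]^o, D t -> z ^~ t @ \oo --> l.
  move=> t; have [Zt|nZt] := boolP (t \in Z).
    by exists 0 => _; rewrite /z Zt; exact: cvg_cst.
  have [Dt|nDt] := pselect (D t); last by exists 0.
  have [|l vl] := v_cvg t Dt; first by move=> /mem_set Zt; rewrite Zt in nZt.
  by exists l => _; rewrite /z (negbTE nZt).
have mg : cmeasurable g.
  apply: (cmeasurable_cvg mz) => t Dt e e0; exact: ((ccvgP _ _ _).1 (gP t Dt) e e0).
have zv : {ae mu, forall t, D t -> forall k, z k t = v k t}.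
  exists Z; split => // t /= nz; apply: contrapT => nZt; apply: nz => _ k.
  by rewrite /z memNset.
have gv j : (sqint (fun t => g t - v j t)%R <= ((2^-1 ^+ j) ^+ 2)%:E)%E.
  have -> : sqint (fun t => g t - v j t)%R = sqint (fun t => g t - z j t)%R.
    by apply/eqP; rewrite eq_le; apply/andP; split;
      (apply: le_sqint; [by apply: cmeasurableB => //; exact: L2_meas
                        |by apply: cmeasurableB => //; exact: L2_meas|]);
      refine (ae_imply zv _) => t zt Dt; rewrite zt.
  have -> : sqint (fun t => g t - z j t)%R =
      (\int[mu]_(t in D)
        limn_einf (fun k => (cnorm (z (k + j)%N t - z j t)%R ^+ 2)%:E))%E.
    apply: eq_integral => t /set_mem Dt; apply/esym.
    apply: (cvg_limn_einf_sup _).1; apply: cvg_EFin; first exact: nearW.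
    apply: (@cvg_comp _ _ _ (fun k => cnorm (z (k + j)%N t - z j t))
      (fun x => x ^+ 2) _ (nbhs (cnorm (g t - z j t)))); last exact: exprn_continuous.
    apply: cvg_cnorm; apply: cvgB; last exact: cvg_cst.
    by rewrite (cvg_shiftn j (fun k => z k t)); exact: gP.
  apply: le_trans (fatou _ _ _ _) _ => //.
  - by move=> n; exact: (measurable_cnorm_sqr (cmeasurableB (mz _) (mz j))).
  - by move=> n t _; rewrite lee_fin sqr_ge0.
  apply: limn_einf_le => n.
  apply: (@le_trans _ _ (sqint (v (n + j)%N - v j))).
    apply: le_sqint; [exact: cmeasurableB|exact: L2_meas|].
    by refine (ae_imply zv _) => t zt Dt; rewrite L2_subE !zt.
  by rewrite sqintE lee_fin ler_pXn2r ?nnegrE ?nrm_ge0 ?exprn_ge0 ?invr_ge0// ltW// vv// leq_addl.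
have Lg : L2_circle g.
  have -> : g = fun t => 1 * (g t - v 0%N t) + v 0%N t.
    by apply/funext => t; rewrite mul1r subrK.
  apply: L2_linear; last exact: L2P.
  apply/L2_circleE; split; first exact: (cmeasurableB mg (L2_meas (v 0%N))).
  by apply: le_lt_trans (gv 0%N) _; exact: ltry.
have vx j : nrm (v j - toL2 g) <= 2^-1 ^+ j.
  rewrite (nrm_distrC H) -(@ler_pXn2r _ 2) ?nnegrE ?nrm_ge0 ?exprn_ge0 ?invr_ge0//.
  rewrite -lee_fin -sqintE; apply: le_trans (gv j).
  rewrite (_ : L2val (toL2 g - v j) = fun t => g t - v j t)//.
  by apply/funext => t; rewrite L2_subE toL2E.
exists (toL2 g) => e e0.
have [j _ je] : \forall j \near \oo, (2^-1 : R) ^+ j < e / 2.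
  have e2 : 0 < e / 2 by rewrite divr_gt0.
  have h : `|2^-1 : R| < 1 by rewrite ger0_norm ?invr_ge0// invf_lt1// ltr1n.
  move/cvgrPdist_lt: (cvg_expr h) => /(_ _ e2); apply: filterS => j.
  by rewrite sub0r normrN ger0_norm// exprn_ge0 ?invr_ge0.
exists (N j) => n Nn; apply: le_lt_trans (nrmB_le H _ (v j) _) _.
have := vx j; have := je j (leqnn j); rewrite /=.
have : nrm (u n - v j) < 2^-1 ^+ j.
  by apply: N0P; [exact: leq_trans (N_ge _ _ (leqnn j)) Nn|exact: N_ge].
rewrite /v; lra.
Qed.

End RieszFischer.

(** * Exponentials, polynomials and multipliers in [L2] *)

Section Exponentials.
Variable R : realType.
Local Notation mu := (@lebesgue_measure R).
Local Notation D := [set` `[0%R : R, 1%R]].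

Let is_derive_scale (k x : R) : is_derive x 1 (fun t => k * t) k.
Proof.
by have := is_deriveZ k (is_derive_id x 1); rewrite scaler1.
Qed.

Let continuous_scale (k : R) : continuous (fun t : R => k * t).
Proof. by move=> x; apply: cvgM; [exact: cvg_cst|exact: cvg_id]. Qed.

Lemma continuous_cos_scale (k : R) : continuous (fun t => cos (k * t)).
Proof.
move=> x; apply: (@continuous_comp _ _ _ (fun t => k * t) (@cos R)).
  exact: continuous_scale.
exact: continuous_cos.
Qed.

Lemma continuous_sin_scale (k : R) : continuous (fun t => sin (k * t)).
Proof.
move=> x; apply: (@continuous_comp _ _ _ (fun t => k * t) (@sin R)).
  exact: continuous_scale.
exact: continuous_sin.
Qed.

Let scaled_derive (F f : R -> R) (k x : R) : k != 0 ->
  is_derive (k * x) 1 F (f (k * x)) ->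
  is_derive x 1 (fun t => k^-1 * F (k * t)) (f (k * x)).
Proof.
move=> k0 dF; have dc := @is_derive1_comp _ F (fun t => k * t) x _ _ dF (is_derive_scale k x).
have := is_deriveZ k^-1 dc.
by rewrite [in X in is_derive _ _ _ X]/GRing.scale /= mulrCA mulVf// mulr1.
Qed.

Lemma Rintegral_cos (k : R) : k != 0 -> \int[mu]_(t in D) cos (k * t) = k^-1 * sin k.
Proof.
move=> k0; rewrite /Rintegral.
rewrite (@continuous_FTC2 _ _ (fun t => k^-1 * sin (k * t)))//.
- by rewrite -EFinB /= mulr0 sin0 mulr0 subr0 mulr1.
- exact/continuous_subspaceT/continuous_cos_scale.
- have c x : {for x, continuous (fun t => k^-1 * sin (k * t))}.
    by apply: cvgM; [exact: cvg_cst|exact: continuous_sin_scale].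
  split.
  + by move=> x _; have [] := scaled_derive k0 (is_derive_sin (k * x)).
  + by apply: cvg_at_right_filter; exact: c.
  + by apply: cvg_at_left_filter; exact: c.
- move=> x _; rewrite derive1E.
  by have [_ ->] := scaled_derive k0 (is_derive_sin (k * x)).
Qed.

Lemma Rintegral_sin (k : R) : k != 0 ->
  \int[mu]_(t in D) sin (k * t) = k^-1 * (1 - cos k).
Proof.
move=> k0; rewrite /Rintegral.
have dc x : is_derive (k * x) 1 (- cos) (sin (k * x)).
  by have := is_deriveN (is_derive_cos (k * x)); rewrite opprK.
rewrite (@continuous_FTC2 _ _ (fun t => k^-1 * (- cos (k * t))))//.
- by rewrite -EFinB /= mulr0 cos0 mulr1 -mulrBr opprK addrC.
- exact/continuous_subspaceT/continuous_sin_scale.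
- have c x : {for x, continuous (fun t => k^-1 * (- cos (k * t)))}.
    by apply: cvgM; [exact: cvg_cst|apply: cvgN; exact: continuous_cos_scale].
  split.
  + by move=> x _; have [] := scaled_derive k0 (dc x).
  + by apply: cvg_at_right_filter; exact: c.
  + by apply: cvg_at_left_filter; exact: c.
- move=> x _; rewrite derive1E.
  by have [_ ->] := scaled_derive k0 (dc x).
Qed.

Lemma circX (t : R) n : circ t ^+ n =
  (cos (2 * pi * n%:R * t) +i* sin (2 * pi * n%:R * t))%C.
Proof.
elim: n => [|n IH]; first by rewrite expr0 mulr0 mul0r cos0 sin0.
rewrite exprS IH /circ.
have -> : 2 * pi * n.+1%:R * t = 2 * pi * t + 2 * pi * n%:R * t.
  by rewrite -natr1; ring.
rewrite cosD sinD.
by apply/eqP; rewrite eq_complex; apply/andP; split; apply/eqP => /=; ring.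
Qed.

Lemma cnorm_circ (t : R) : cnorm (circ t) = 1.
Proof.
by apply/eqP; rewrite -(@eqrXn2 _ 2) ?cnorm_ge0// cnorm_sqr /= cos2Dsin2 expr1n.
Qed.

Lemma circJ (t : R) : circ t * conjc (circ t) = 1.
Proof. by rewrite mulcJ cnorm_circ expr1n. Qed.

(** The integrals of the coordinates are elementary, and the exponential has
    period one. *)
Lemma cint_circX n : cint (fun t : R => circ t ^+ n) = (n == 0%N)%:R.
Proof.
rewrite /cint; under eq_Rintegral do rewrite circX /=.
under [X in (_ +i* X)%C]eq_Rintegral do rewrite circX /=.
have [->|n0] := eqVneq n 0%N.
  under eq_Rintegral do rewrite mulr0 mul0r cos0.
  under [X in (_ +i* X)%C]eq_Rintegral do rewrite mulr0 mul0r sin0.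
  by rewrite !Rintegral_cst//= muD mul0r mul1r.
have k0 : 2 * pi * n%:R != 0 :> R by rewrite !mulf_neq0 ?pnatr_eq0// gt_eqF// pi_gt0.
have per m : cos (2 * pi * m%:R : R) = 1 /\ sin (2 * pi * m%:R : R) = 0.
  elim: m => [|m [cm sm]]; first by rewrite mulr0 cos0 sin0.
  have -> : 2 * pi * m.+1%:R = 2 * pi * m%:R + pi *+ 2 :> R.
    by rewrite -[m.+1]addn1 natrD mulrDr mulr1 mulr_natl.
  by rewrite cosD2pi sinD2pi.
have [cn sn] := per n.
by rewrite Rintegral_cos// Rintegral_sin// cn sn subrr !mulr0.
Qed.

Lemma cmeasurable_circ : cmeasurable (@circ R).
Proof.
by split; apply: measurable_funTS; apply: continuous_measurable_fun;
  [exact: continuous_cos_scale|exact: continuous_sin_scale].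
Qed.

Lemma cmeasurable_horner (p : {poly R[i]}) (f : R -> R[i]) :
  cmeasurable f -> cmeasurable (fun t => p.[f t]).
Proof.
move=> mf; elim/poly_ind: p => [|p c IH].
  have -> : (fun t => (0 : {poly R[i]}).[f t]) = fun=> 0.
    by apply/funext => t; rewrite horner0.
  exact: cmeasurable_cst.
have -> : (fun t => (p * 'X + c%:P).[f t]) = fun t => p.[f t] * f t + c.
  by apply/funext => t; rewrite hornerMXaddC.
by apply: cmeasurableD; [exact: cmeasurableM|exact: cmeasurable_cst].
Qed.

(** A bound of the modulus of [p] on the closed disc, see [horner_le]. *)
Definition poly_bound (p : {poly R[i]}) : R := \sum_(i < size p) cnorm p`_i.

Lemma horner_le (p : {poly R[i]}) (z : R[i]) : cnorm z <= 1 ->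
  cnorm p.[z] <= poly_bound p.
Proof.
move=> z1; rewrite horner_coef (le_trans (cnorm_sum _ _ _))// ler_sum// => i _.
by rewrite cnormM cnormX ler_piMr ?cnorm_ge0// exprn_ile1 ?cnorm_ge0.
Qed.

Definition ess_bounded (M : R) (f : R -> R[i]) : Prop :=
  cmeasurable f /\ {ae mu, forall t, D t -> cnorm (f t) <= M}.

Lemma ess_boundedW M f : cmeasurable f -> (forall t, cnorm (f t) <= M) ->
  ess_bounded M f.
Proof. by move=> mf fM; split => //; apply: aeW => t _; exact: fM. Qed.

Lemma ess_bounded_horner (p : {poly R[i]}) :
  ess_bounded (poly_bound p) (fun t => p.[circ t]).
Proof.
apply: ess_boundedW => [|t]; first exact/cmeasurable_horner/cmeasurable_circ.
by rewrite horner_le// cnorm_circ.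
Qed.

Lemma ess_bounded_conj M f : ess_bounded M f -> ess_bounded M (fun t => conjc (f t)).
Proof.
move=> [mf fM]; split; first exact: cmeasurableJ.
by refine (ae_imply fM _) => t ft Dt; rewrite cnormJ ft.
Qed.

Definition mulL2 : (R -> R[i]) -> L2 R -> L2 R :=
  locked_with L2_key (fun f x => toL2 (fun t => f t * x t)).

Lemma mulL2E M f (x : L2 R) t : ess_bounded M f -> mulL2 f x t = f t * x t.
Proof.
move=> [mf fM]; rewrite /mulL2 locked_withE toL2E//.
exact: L2_mul_bounded mf fM (L2P x).
Qed.

Lemma L2_eqP (x y : L2 R) : (forall t, x t = y t) -> x = y.
Proof. by move=> xy; apply/val_inj/funext. Qed.

Lemma mulL2B M f (x y : L2 R) : ess_bounded M f ->
  mulL2 f (x - y) = mulL2 f x - mulL2 f y.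
Proof.
move=> bf; apply: L2_eqP => t.
by rewrite L2_subE !(mulL2E _ _ bf) L2_subE mulrBr.
Qed.

Lemma mulL2_linear M f a (x y : L2 R) : ess_bounded M f ->
  mulL2 f (a *: x + y) = a *: mulL2 f x + mulL2 f y.
Proof.
move=> bf; apply: L2_eqP => t.
by rewrite L2_addE L2_scaleE !(mulL2E _ _ bf) L2_addE L2_scaleE mulrDr mulrCA.
Qed.

Local Notation nrm := (nrm (@ip R)).

Lemma nrm_mulL2 M f (x : L2 R) : ess_bounded M f -> 0 <= M ->
  nrm (mulL2 f x) <= M * nrm x.
Proof.
move=> bf M0; rewrite -(@ler_pXn2r _ 2) ?nnegrE ?mulr_ge0 ?nrm_ge0//.
have -> : (M * nrm x) ^+ 2 = M ^+ 2 * nrm x ^+ 2 by rewrite exprMn.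
rewrite -lee_fin (EFinM (M ^+ 2)) -!sqintE.
have -> : L2val (mulL2 f x) = fun t => f t * x t.
  by apply/funext => t; rewrite (mulL2E _ _ bf).
have -> : (M ^+ 2)%:E = (cnorm (M%:C%C : R[i]) ^+ 2)%:E.
  by rewrite cnormR real_normK ?num_real.
rewrite -sqintZ; last exact: L2_meas.
have [mf fM] := bf; apply: le_sqint.
- by apply: cmeasurableM => //; exact: L2_meas.
- exact/cmeasurableZ/L2_meas.
refine (ae_imply fM _) => t ft Dt; rewrite !cnormM ler_wpM2r ?cnorm_ge0//.
by rewrite cnormR ger0_norm// ft.
Qed.

Lemma ip_mulL2_unimodular M f (x y : L2 R) : ess_bounded M f ->
  {ae mu, forall t, D t -> cnorm (f t) = 1} ->
  ip (mulL2 f x) (mulL2 f y) = ip x y.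
Proof.
move=> bf f1; have [mf _] := bf; rewrite !ipE; apply: ae_eq_cint.
- by apply: cmeasurableM; [|apply: cmeasurableJ]; exact: L2_meas.
- by apply: cmeasurableM; [|apply: cmeasurableJ]; exact: L2_meas.
refine (ae_imply f1 _) => t ft Dt; rewrite !(mulL2E _ _ bf) conjcM mulrACA.
by rewrite mulcJ ft // expr1n mul1r.
Qed.

Definition conjL2 : L2 R -> L2 R :=
  locked_with L2_key (fun x => toL2 (fun t => conjc (x t))).

Lemma conjL2E (x : L2 R) t : conjL2 x t = conjc (x t).
Proof. by rewrite /conjL2 locked_withE toL2E//; exact/L2_conj/L2P. Qed.

Lemma conjL2B (x y : L2 R) : conjL2 (x - y) = conjL2 x - conjL2 y.
Proof. by apply: L2_eqP => t; rewrite L2_subE !conjL2E L2_subE conjcB. Qed.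

Lemma nrm_conjL2 (x : L2 R) : nrm (conjL2 x) = nrm x.
Proof.
apply/eqP; rewrite -(@eqrXn2 _ 2) ?nrm_ge0//; apply/eqP.
apply: EFin_inj; rewrite -!sqintE /sqint.
by apply: eq_integral => t _; rewrite conjL2E cnormJ.
Qed.

Definition polyL2 : {poly R[i]} -> L2 R :=
  locked_with L2_key (fun p => toL2 (fun t => p.[circ t])).

Lemma polyL2E (p : {poly R[i]}) t : polyL2 p t = p.[circ t].
Proof.
rewrite /polyL2 locked_withE toL2E//.
by have [mp bp] := ess_bounded_horner p; exact: L2_bounded mp bp.
Qed.

Lemma polyL2D p q : polyL2 (p + q) = polyL2 p + polyL2 q.
Proof. by apply: L2_eqP => t; rewrite L2_addE !polyL2E hornerD. Qed.

Lemma polyL2Z a p : polyL2 (a *: p) = a *: polyL2 p.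
Proof. by apply: L2_eqP => t; rewrite L2_scaleE !polyL2E hornerZ. Qed.

Lemma polyL2_0 : polyL2 0 = 0.
Proof. by apply: L2_eqP => t; rewrite polyL2E horner0. Qed.

Lemma polyL2_sum (I : Type) (r : seq I) (F : I -> {poly R[i]}) :
  polyL2 (\sum_(i <- r) F i) = \sum_(i <- r) polyL2 (F i).
Proof.
by elim: r => [|i r IH]; rewrite ?big_nil ?polyL2_0// !big_cons polyL2D IH.
Qed.

Lemma polyL2_coef p : polyL2 p = \sum_(i < size p) p`_i *: polyL2 'X^i.
Proof.
rewrite -[p in LHS]coefK poly_def polyL2_sum.
by apply: eq_bigr => i _; rewrite polyL2Z.
Qed.

Lemma polyL2M p q : polyL2 (p * q) = mulL2 (fun t => p.[circ t]) (polyL2 q).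
Proof.
apply: L2_eqP => t; rewrite (mulL2E _ _ (ess_bounded_horner p)).
by rewrite !polyL2E hornerM.
Qed.

Local Notation e n := (polyL2 'X^n).

Lemma ip_exp m n : ip (e m) (e n) = (m == n)%:R.
Proof.
have key k l : (l <= k)%N -> ip (e k) (e l) = (k == l)%:R.
  move=> lk; have -> : (k == l) = ((k - l)%N == 0%N).
    by rewrite subn_eq0 eqn_leq lk andbT.
  rewrite -cint_circX ipE; apply: eq_cint => t _; rewrite !polyL2E !hornerXn conjcX.
  by rewrite -[in LHS](subnK lk) exprD -mulrA -exprMn circJ expr1n mulr1.
have [nm|mn] := leqP n m; first exact: key.
rewrite (ip_conj (@semi_inner_ip R)) key 1?ltnW// eq_sym.
by case: eqP => _; rewrite ?conjc1 ?conjc0.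
Qed.

(** A monomial and a conjugate monomial have frequencies of opposite sign. *)
Lemma ip_exp_conj m n : ip (e m) (conjL2 (e n.+1)) = 0.
Proof.
rewrite ipE (@eq_cint _ _ (fun t => circ t ^+ (m + n.+1))) ?cint_circX ?addnS//.
by move=> t _; rewrite conjL2E conjcK !polyL2E !hornerXn -addnS exprD.
Qed.

Lemma nrm_exp n : nrm (e n) = 1.
Proof. by rewrite nrmE ip_exp eqxx sqrtr1. Qed.

End Exponentials.

(** * Boundary functions and their extension to the disc *)

Section PowerSeries.
Variable R : realType.

Lemma discE (z : R[i]) : disc z <-> cnorm z < 1.
Proof. by rewrite /disc /= -cnorm_ltC. Qed.

Lemma geometric_le_inv (q : R) m n : 0 <= q < 1 ->
  \sum_(m <= k < n) q ^+ k <= q ^+ m / (1 - q).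
Proof.
move=> /andP[q0 q1]; have q1' : 0 < 1 - q by rewrite subr_gt0.
rewrite ler_pdivlMr// mulr_suml.
have [mn|nm] := leqP m n; last by rewrite big_geq ?exprn_ge0// ltnW.
rewrite (eq_bigr (fun k => - (q ^+ k.+1 - q ^+ k))); last first.
  by move=> k _; rewrite opprB mulrBr mulr1 -exprSr.
by rewrite sumrN telescope_sumr// opprB lerBlDr lerDl exprn_ge0.
Qed.

Lemma dominated_series_cvg (c : nat -> R[i]) (K q : R) : 0 <= q < 1 ->
  (forall n, cnorm (c n) <= K * q ^+ n) ->
  exists2 l : R[i]^o, series (c : nat -> R[i]^o) @ \oo --> l
    & forall N, cnorm (l - \sum_(n < N) c n) <= K * (q ^+ N / (1 - q)).
Proof.
move=> q01 cK; have K0 : 0 <= K.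
  by have := le_trans (cnorm_ge0 _) (cK 0%N); rewrite expr0 mulr1.
have [l cl] : exists l : R[i]^o, series (c : nat -> R[i]^o) @ \oo --> l.
  apply: cseries_abs_cvg; apply: nondecreasing_is_cvgn.
    by apply/nondecreasing_series => k _ _; exact: cnorm_ge0.
  exists (K * (q ^+ 0 / (1 - q))) => _ [n _ <-].
  apply: le_trans (ler_wpM2l K0 (geometric_le_inv 0 n q01)).
  by rewrite /series /= mulr_sumr ler_sum.
exists l => // N; apply/ler_addgt0Pl => e e0.
have [M _ clM] := (ccvgP _ _ _).1 cl e e0.
have := clM (maxn M N) (leq_maxl _ _); set n := maxn M N => ln.
rewrite -(subrK (series (c : nat -> R[i]^o) n) l) -addrA.
apply: le_trans (cnormD _ _) _; apply: lerD; first by rewrite cnorm_distrC ltW.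
rewrite /series /= -(big_mkord xpredT c) (@big_cat_nat _ _ _ N 0 n)//= ?leq_maxr//.
rewrite addrAC subrr add0r; apply: le_trans (cnorm_sum _ _ _) _.
apply: le_trans (ler_wpM2l K0 (geometric_le_inv N n q01)).
by rewrite mulr_sumr ler_sum.
Qed.

Lemma cseries_linear_cvg (a : R[i]) (c d : nat -> R[i]) (l m : R[i]^o) :
  series (c : nat -> R[i]^o) @ \oo --> l -> series (d : nat -> R[i]^o) @ \oo --> m ->
  series (fun n => a * c n + d n : R[i]^o) @ \oo --> (a * l + m : R[i]^o).
Proof.
move=> cl dm.
have -> : series (fun n => a * c n + d n : R[i]^o) =
    (fun n => a *: series (c : nat -> R[i]^o) n) \+ series (d : nat -> R[i]^o).
  by apply/funext => n; rewrite /series /= scaler_sumr -big_split.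
by apply: cvgD dm; apply: (@cvgZl_tmp _ R[i]^o).
Qed.

End PowerSeries.

Lemma ler_of_sqr (R : realType) (a b : R) : 0 <= b -> a ^+ 2 <= b ^+ 2 -> a <= b.
Proof.
move=> b0 ab; have [//|ba] := leP a b; move: ab.
have a0 : 0 <= a := le_trans b0 (ltW ba).
by rewrite ler_pXn2r ?nnegrE// leNgt ba.
Qed.

Section Hardy.
Variable R : realType.
Local Notation mu := (@lebesgue_measure R).
Local Notation D := [set` `[0%R : R, 1%R]].
Local Notation nrm := (nrm (@ip R)).
Local Notation e n := (polyL2 ('X^n : {poly R[i]})).
Let H := @semi_inner_ip R.
Implicit Types b : L2 R.

(** The closure of the analytic polynomials in [L2]: these are the boundary
    functions of the Hardy space, see [H2_hardy] and [hardy_boundary]. *)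
Definition hardy b : Prop :=
  forall d, 0 < d -> exists p : {poly R[i]}, nrm (b - polyL2 p) < d.

Lemma hardy_poly (p : {poly R[i]}) : hardy (polyL2 p).
Proof. by move=> d d0; exists p; rewrite subrr (nrm0 H). Qed.

Lemma hardy_closed b : (forall d, 0 < d -> exists2 x, hardy x & nrm (b - x) < d) ->
  hardy b.
Proof.
move=> bx d d0; have d2 : 0 < d / 2 by rewrite divr_gt0.
have [x hx bx2] := bx _ d2; have [p xp] := hx _ d2; exists p.
by rewrite [d]splitr (le_lt_trans (nrmB_le H _ x _))// ltrD.
Qed.

Lemma hardy_linear a b c : hardy b -> hardy c -> hardy (a *: b + c).
Proof.
move=> hb hc d d0.
have a1 : 0 < cnorm a + 1 by rewrite ltr_wpDl ?cnorm_ge0.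
have [p bp] := hb (d / 2 / (cnorm a + 1)) (divr_gt0 (divr_gt0 d0 (ltr0n _ 2)) a1).
have [q cq] := hc (d / 2) (divr_gt0 d0 (ltr0n _ 2)).
exists (a *: p + q); rewrite polyL2D polyL2Z.
have -> : a *: b + c - (a *: polyL2 p + polyL2 q) =
    a *: (b - polyL2 p) + (c - polyL2 q).
  by rewrite scalerBr opprD addrACA.
rewrite [d]splitr (le_lt_trans (nrmD H _ _))// ler_ltD// (nrmZ H).
rewrite ltr_pdivlMr// in bp.
rewrite mulrC (le_trans _ (ltW bp))// ler_wpM2l ?nrm_ge0// lerDl.
exact: ler01.
Qed.

Lemma hardyB b c : hardy b -> hardy c -> hardy (b - c).
Proof.
by move=> hb hc; rewrite addrC -scaleN1r; exact: hardy_linear.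
Qed.

Lemma cnorm_coef b n : cnorm (ip b (e n)) <= nrm b.
Proof. by rewrite (le_trans (cauchy_schwarz H _ _))// nrm_exp mulr1. Qed.

(** The Cauchy integral of [b], defined through its coefficients.  For [b] in
    [hardy] it is the function on the disc with boundary values [b]. *)
Definition ext : L2 R -> R[i] -> R[i] := locked_with L2_key (fun b z =>
  lim (series (fun n => ip b (e n) * z ^+ n : R[i]^o) @ \oo)).

Lemma extE b z : ext b z = lim (series (fun n => ip b (e n) * z ^+ n : R[i]^o) @ \oo).
Proof. by rewrite /ext locked_withE. Qed.

(** The coefficients are bounded by the norm of [b], so the series is dominated
    by a geometric one.  The resulting bound makes evaluation at [z] continuous
    in [b], which carries identities from polynomials to [hardy] functions. *)
Lemma ext_spec b z : disc z ->
  series (fun n => ip b (e n) * z ^+ n : R[i]^o) @ \oo --> (ext b z : R[i]^o) /\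
  cnorm (ext b z) <= nrm b / (1 - cnorm z).
Proof.
move=> /discE z1; have z01 : 0 <= cnorm z < 1 by rewrite cnorm_ge0.
have bz n : cnorm (ip b (e n) * z ^+ n) <= nrm b * cnorm z ^+ n.
  by rewrite cnormM cnormX ler_wpM2r ?exprn_ge0 ?cnorm_ge0// cnorm_coef.
have [l cl lN] := dominated_series_cvg z01 bz.
have -> : ext b z = l by rewrite extE; exact: cvg_lim cl.
split=> //; have := lN 0%N.
by rewrite big_ord0 subr0 expr0 mul1r.
Qed.

Lemma ext_linear a b c z : disc z -> ext (a *: b + c) z = a * ext b z + ext c z.
Proof.
move=> dz; have [bz _] := ext_spec b dz; have [cz _] := ext_spec c dz.
rewrite extE; apply: (@cvg_lim R[i]^o); first exact: norm_hausdorff.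
have -> : (fun n => ip (a *: b + c) (e n) * z ^+ n : R[i]^o) =
    (fun n => a * (ip b (e n) * z ^+ n) + ip c (e n) * z ^+ n).
  by apply/funext => n; rewrite (ip_linear H) mulrDl -mulrA.
exact: cseries_linear_cvg bz cz.
Qed.

Lemma extB b c z : disc z -> ext (b - c) z = ext b z - ext c z.
Proof. by move=> dz; rewrite addrC -scaleN1r ext_linear// mulN1r addrC. Qed.

Lemma ip_poly (p : {poly R[i]}) n : ip (polyL2 p) (e n) = p`_n.
Proof.
rewrite polyL2_coef -(big_mkord xpredT (fun i => p`_i *: e i)).
rewrite (ip_sum_orthonormal H (@ip_exp R)) ?iota_uniq// mem_index_iota /=.
by case: ltnP => // h; rewrite nth_default.
Qed.

Lemma ext_poly (p : {poly R[i]}) z : ext (polyL2 p) z = p.[z].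
Proof.
rewrite extE; apply: (@cvg_lim R[i]^o) => //; apply: (@cvg_near_cst _ R[i]^o).
exists (size p) => // n /= pn; rewrite /series /= horner_coef.
rewrite (@big_cat_nat _ _ _ (size p) 0 n)//= big_mkord.
rewrite [X in _ + X]big_nat_cond [X in _ + X]big1 ?addr0.
  by apply: eq_bigr => i _; rewrite ip_poly.
by move=> i /andP[/andP[pi _] _]; rewrite ip_poly nth_default// mul0r.
Qed.

Section Dilation.
Variable r : R.
Hypothesis r01 : 0 <= r < 1.

Let r0 : 0 <= r. Proof. by case/andP: r01. Qed.
Let r1 : 0 < 1 - r. Proof. by case/andP: r01 => _; rewrite subr_gt0. Qed.

Lemma cnorm_dil t : cnorm (r%:C%C * circ t) = r.
Proof. by rewrite cnormM cnormR cnorm_circ mulr1 ger0_norm. Qed.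

Lemma disc_dil t : disc (r%:C%C * circ t).
Proof. by apply/discE; rewrite cnorm_dil; case/andP: r01. Qed.

Definition dil_poly (p : {poly R[i]}) := \poly_(i < size p) (p`_i * r%:C%C ^+ i).

Lemma horner_dil_poly p z : (dil_poly p).[z] = p.[r%:C%C * z].
Proof.
rewrite horner_poly horner_coef; apply: eq_bigr => i _.
by rewrite exprMn mulrA.
Qed.

Lemma polyL2_dil_poly p :
  polyL2 (dil_poly p) = \sum_(i < size p) (p`_i * r%:C%C ^+ i) *: e i.
Proof.
by rewrite /dil_poly poly_def polyL2_sum; apply: eq_bigr => i _; rewrite polyL2Z.
Qed.

Lemma nrm_poly_sqr (c : nat -> R[i]) n :
  nrm (\sum_(i < n) c i *: e i) ^+ 2 = \sum_(i < n) cnorm (c i) ^+ 2.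
Proof.
rewrite -(big_mkord xpredT (fun i => c i *: e i)).
by rewrite (nrm_sum_orthonormal H (@ip_exp R)) ?iota_uniq// big_mkord.
Qed.

(** Dilation multiplies the [n]-th coefficient by [r ^+ n <= 1]. *)
Lemma nrm_dil_poly p : nrm (polyL2 (dil_poly p)) <= nrm (polyL2 p).
Proof.
apply: ler_of_sqr; first exact: nrm_ge0.
rewrite polyL2_dil_poly [in leRHS]polyL2_coef.
rewrite (nrm_poly_sqr (fun i => p`_i * r%:C%C ^+ i)) (nrm_poly_sqr (fun i => p`_i)).
apply: ler_sum => i _; rewrite ler_pXn2r ?nnegrE ?cnorm_ge0//.
rewrite cnormM cnormX cnormR ger0_norm// ler_piMr ?cnorm_ge0//.
by rewrite exprn_ile1// ltW//; case/andP: r01.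
Qed.

Lemma bernoulli_le n : 1 - r ^+ n <= n%:R * (1 - r).
Proof.
elim: n => [|n IH]; first by rewrite expr0 subrr mul0r.
have rn : r ^+ n <= 1 by rewrite exprn_ile1// ltW//; case/andP: r01.
have rn0 : 0 <= r ^+ n by rewrite exprn_ge0.
rewrite -natr1 exprS; have := r1; nra.
Qed.

Lemma nrm_dil_poly_sub p : nrm (polyL2 (dil_poly p) - polyL2 p) <=
  (1 - r) * \sum_(i < size p) cnorm p`_i * i%:R.
Proof.
rewrite polyL2_dil_poly [X in _ - X]polyL2_coef -sumrB mulr_sumr.
elim/big_ind2: _ => [|x a y b xa yb|i _]; first by rewrite (nrm0 H).
  by rewrite (le_trans (nrmD H _ _))// lerD.
rewrite -scalerBl (nrmZ H) nrm_exp mulr1 -[X in _ - X]mulr1 -mulrBr cnormM.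
rewrite mulrCA ler_wpM2l ?cnorm_ge0// mulrC cnorm_distrC.
apply: le_trans (bernoulli_le i).
have -> : 1 - r%:C%C ^+ i = (1 - r ^+ i)%:C%C by rewrite rmorphB rmorphXn.
rewrite cnormR ger0_norm// subr_ge0 exprn_ile1// ltW//; by case/andP: r01.
Qed.

Definition dil b : L2 R := toL2 (fun t => ext b (r%:C%C * circ t)).

Lemma ext_dil_approx b p t :
  cnorm (ext b (r%:C%C * circ t) - (dil_poly p).[circ t]) <=
  nrm (b - polyL2 p) / (1 - r).
Proof.
rewrite horner_dil_poly -ext_poly -extB; last exact: disc_dil.
have [_] := ext_spec (b - polyL2 p) (disc_dil t); by rewrite cnorm_dil.
Qed.

Lemma dil_L2 b : hardy b -> L2_circle (fun t => ext b (r%:C%C * circ t)).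
Proof.
move=> hb; apply: (@L2_bounded _ (nrm b / (1 - r))); last first.
  apply: aeW => t _; have [_] := ext_spec b (disc_dil t); by rewrite cnorm_dil.
have /choice[p pP] : forall n : nat, exists p, nrm (b - polyL2 p) < n.+1%:R^-1.
  by move=> n; apply: hb; rewrite invr_gt0.
apply: (@cmeasurable_cvg _ (fun n t => (dil_poly (p n)).[circ t])).
  by move=> n; exact/cmeasurable_horner/cmeasurable_circ.
move=> t _ d d0; have dr0 : 0 < d * (1 - r) by rewrite mulr_gt0.
apply: filterS (near_infty_natSinv_lt (PosNum dr0)) => n /= nd.
rewrite cnorm_distrC (le_lt_trans (ext_dil_approx _ _ _))// ltr_pdivrMr//.
exact: lt_trans (pP n) nd.
Qed.

Lemma dilE b t : hardy b -> dil b t = ext b (r%:C%C * circ t).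
Proof. by move=> hb; rewrite /dil toL2E//; exact: dil_L2. Qed.

Lemma nrm_le_sup (x : L2 R) (M : R) : 0 <= M -> (forall t, cnorm (x t) <= M) -> nrm x <= M.
Proof.
move=> M0 xM; rewrite -(@ler_pXn2r _ 2) ?nnegrE ?nrm_ge0// -lee_fin -sqintE.
have -> : (M ^+ 2)%:E = sqint (fun _ : R => M%:C%C).
  rewrite /sqint; under eq_integral do rewrite cnormR ger0_norm//.
  by rewrite integral_cst//= muD mule1.
apply: le_sqint; [exact: L2_meas|exact: cmeasurable_cst|].
by apply: aeW => t _; rewrite cnormR ger0_norm.
Qed.

(** Inherited from polynomials: on the circle of radius [r] the extension is a
    uniform limit of polynomials. *)
Lemma nrm_dil b : hardy b -> nrm (dil b) <= nrm b.
Proof.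
move=> hb; apply/ler_addgt0Pl => d d0.
have k0 : 0 < 1 + (1 - r)^-1 by rewrite ltr_wpDr// invr_ge0 ltW.
have [p bp] := hb _ (divr_gt0 d0 k0).
have h1 : nrm (dil b - polyL2 (dil_poly p)) <= nrm (b - polyL2 p) / (1 - r).
  apply: nrm_le_sup; first by rewrite divr_ge0 ?nrm_ge0 ?ltW.
  by move=> t; rewrite L2_subE dilE// polyL2E ext_dil_approx.
apply: le_trans (nrm_le_dist H _ (polyL2 (dil_poly p))) _.
have := nrm_le_dist H (polyL2 p) b; rewrite (nrm_distrC H).
have := nrm_dil_poly p; move: bp; rewrite ltr_pdivlMr// mulrDr mulr1.
move: h1; move: (nrm (b - polyL2 p)) (nrm (dil b - _)) => x1 x2.
move: (nrm (polyL2 (dil_poly p))) (nrm (polyL2 p)) (nrm b) => x3 x4 x5.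
by move: (1 - r)^-1 => y *; lra.
Qed.

Lemma dilB b c : hardy b -> hardy c -> dil (b - c) = dil b - dil c.
Proof.
move=> hb hc; apply: L2_eqP => t.
apply: etrans (dilE t (hardyB hb hc)) _; apply: etrans (extB b c (disc_dil t)) _.
exact: (esym (congr2 (fun x y => x - y) (dilE t hb) (dilE t hc))).
Qed.

Lemma dil_polyL2 p : dil (polyL2 p) = polyL2 (dil_poly p).
Proof.
apply: L2_eqP => t; rewrite dilE; last exact: hardy_poly.
by rewrite ext_poly polyL2E horner_dil_poly.
Qed.

End Dilation.

End Hardy.

(** * The Hardy space and its boundary functions *)

Section HardyBoundary.
Variable R : realType.
Local Notation mu := (@lebesgue_measure R).
Local Notation D := [set` `[0%R : R, 1%R]].
Local Notation nrm := (nrm (@ip R)).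
Local Notation e n := (polyL2 ('X^n : {poly R[i]})).
Let H := @semi_inner_ip R.
Implicit Types b : L2 R.

(** Convergence is clear for polynomials, and dilations are contractions
    ([nrm_dil]), so it extends to their closure. *)
Lemma dil_cvg b d : hardy b -> 0 < d ->
  \forall r \near (1 : R)^'-, 0 <= r < 1 /\ nrm (dil r b - b) < d.
Proof.
move=> hb d0; have d3 : 0 < d / 3 by rewrite divr_gt0.
have [p bp] := hb _ d3.
pose K := \sum_(i < size p) cnorm p`_i * i%:R.
have K0 : 0 <= K by rewrite sumr_ge0// => i _; rewrite mulr_ge0 ?cnorm_ge0.
have K1 : 0 < K + 1 by rewrite ltr_wpDl.
have k3 : 0 < d / 3 / (K + 1) by rewrite divr_gt0.
near=> r.
have r01 : 0 <= r < 1.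
  apply/andP; split; last by near: r; exact: nbhs_left_lt.
  by near: r; exact: nbhs_left_ge.
split=> //.
have h1 : nrm (dil r b - dil r (polyL2 p)) < d / 3.
  rewrite -(dilB r01 hb (hardy_poly p)); apply: le_lt_trans bp.
  exact/(nrm_dil r01)/hardyB/hardy_poly.
have h2 : nrm (dil r (polyL2 p) - polyL2 p) < d / 3.
  rewrite (dil_polyL2 r01); apply: le_lt_trans (nrm_dil_poly_sub r01 p) _.
  have rk : 1 - r < d / 3 / (K + 1).
    by rewrite ltrBlDr -ltrBlDl; near: r; apply: nbhs_left_gt; rewrite ltrBlDr ltrDl.
  apply: (@le_lt_trans _ _ ((1 - r) * (K + 1))).
    by rewrite ler_wpM2l ?lerDl// subr_ge0 ltW//; case/andP: r01.
  by rewrite -ltr_pdivlMr.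
have h3 : nrm (polyL2 p - b) < d / 3 by rewrite (nrm_distrC H); exact: bp.
exact: nrm_chain3 h1 h2 h3.
Unshelve. all: by end_near. Qed.

Lemma sqint_dil b r : hardy b -> 0 <= r < 1 ->
  sqint (fun t => ext b (r%:C%C * circ t)) = (nrm (dil r b) ^+ 2)%:E.
Proof.
by move=> hb r01; rewrite -sqintE; congr sqint; apply/funext => t; rewrite dilE.
Qed.

Lemma sqint_dil_sub b r (g : L2 R) : hardy b -> 0 <= r < 1 ->
  sqint (fun t => ext b (r%:C%C * circ t) - g t) = (nrm (dil r b - g) ^+ 2)%:E.
Proof.
move=> hb r01; rewrite -sqintE; congr sqint; apply/funext => t.
by rewrite [RHS]L2_subE dilE.
Qed.

Lemma hardy_boundary b : hardy b -> boundary_function (ext b) b.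
Proof.
move=> hb; split; first exact: L2P.
apply/fine_cvgP; split.
  by apply: filterS (dil_cvg hb ltr01) => r [r01 _]; rewrite sqint_dil_sub.
apply/cvgrPdist_lt => d d0.
have d0' : 0 < Num.min d 1 by rewrite lt_min d0 ltr01.
apply: filterS (dil_cvg hb d0') => r [r01]; rewrite /= sqint_dil_sub//= sub0r normrN.
rewrite lt_min => /andP[rd r1]; rewrite ger0_norm ?sqr_ge0//.
apply: le_lt_trans rd; rewrite expr2 ler_piMl ?nrm_ge0//; exact: ltW.
Qed.

(** The norms on smaller circles do not exceed that of [b] and converge to
    it. *)
Lemma H2norm_ext b : hardy b -> H2norm (ext b) = (nrm b)%:E.
Proof.
move=> hb; rewrite /H2norm; set S := (X in ereal_sup X).
have S_le x : S x -> (x <= (nrm b ^+ 2)%:E)%E.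
  move=> [r /= r01 <-]; rewrite sqint_dil// lee_fin ler_pXn2r ?nnegrE ?nrm_ge0//.
  exact: nrm_dil.
suff -> : ereal_sup S = (nrm b ^+ 2)%:E.
  by rewrite poweR_EFin powR12_sqrt ?sqr_ge0// sqrtr_sqr ger0_norm ?nrm_ge0.
apply/eqP; rewrite eq_le; apply/andP; split; first exact: ge_ereal_sup.
have S_ge r : 0 <= r < 1 -> ((nrm (dil r b) ^+ 2)%:E <= ereal_sup S)%E.
  by move=> r01; apply: ereal_sup_ubound; exists r => //; rewrite sqint_dil.
case: (ereal_sup S) S_ge => [s| |] S_ge; last 2 first.
- exact: leey.
- by have := S_ge 0; rewrite lexx ltr01 => /(_ isT).
have s0 : 0 <= s.
  have := S_ge 0; rewrite lexx ltr01 => /(_ isT); rewrite lee_fin.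
  exact/le_trans/sqr_ge0.
have S_sqrt r : 0 <= r < 1 -> nrm (dil r b) <= Num.sqrt s.
  move=> r01; apply: ler_of_sqr; first exact: sqrtr_ge0.
  by rewrite (sqr_sqrtr s0) -lee_fin; exact: S_ge.
rewrite lee_fin; suff bs : nrm b <= Num.sqrt s.
  by rewrite -[leRHS](sqr_sqrtr s0) ler_pXn2r ?nnegrE ?nrm_ge0 ?sqrtr_ge0.
apply/ler_addgt0Pl => d /(dil_cvg hb) /filter_ex[r [r01 rd]].
have := nrm_le_dist H b (dil r b); rewrite (nrm_distrC H).
move: (S_sqrt r r01) rd.
move: (nrm _) (nrm _) (nrm _) (Num.sqrt s) => *; lra.
Qed.

Lemma analytic_ext b : analytic (ext b).
Proof. by exists (fun n => ip b (e n)) => z /(ext_spec b)[]. Qed.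

Lemma H2_ext b : hardy b -> H2 (ext b).
Proof. by move=> hb; split; [exact: analytic_ext|rewrite H2norm_ext// ltry]. Qed.

Lemma H2norm_eq (f g : R[i] -> R[i]) : eq_on_disc f g -> H2norm f = H2norm g.
Proof.
move=> fg; rewrite /H2norm; congr (ereal_sup _ `^ _)%E; apply/seteqP.
by split=> _ [r /= r01 <-]; exists r => //; congr sqint; apply/funext => t;
  rewrite fg//; exact: disc_dil.
Qed.

Lemma analytic_eq (f g : R[i] -> R[i]) : eq_on_disc f g -> analytic g -> analytic f.
Proof. by move=> fg [a ga]; exists a => z dz; rewrite fg//; exact: ga. Qed.

Lemma H2_eq (f g : R[i] -> R[i]) : eq_on_disc f g -> H2 g -> H2 f.
Proof.
by move=> fg [ag gy]; split; [exact: analytic_eq ag|rewrite (H2norm_eq fg)].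
Qed.

Lemma boundary_function_eq (f g : R[i] -> R[i]) (h : R -> R[i]) :
  eq_on_disc f g -> boundary_function g h -> boundary_function f h.
Proof.
move=> fg [Lh gh]; split=> //; apply: cvg_trans gh; apply: near_eq_cvg.
near=> r; congr sqint; apply/funext => t; rewrite fg//; apply: disc_dil.
apply/andP; split; last by near: r; exact: nbhs_left_lt.
by apply: ltW; near: r; exact: nbhs_left_gt.
Unshelve. all: by end_near. Qed.

Lemma eq_on_disc_sym (f g : R[i] -> R[i]) : eq_on_disc f g -> eq_on_disc g f.
Proof. by move=> fg z /fg. Qed.

Lemma boundary_unique (f : R[i] -> R[i]) (g : R -> R[i]) b :
  hardy b -> eq_on_disc f (ext b) -> boundary_function f g -> nrm (toL2 g - b) = 0.
Proof.
move=> hb fb /(boundary_function_eq (eq_on_disc_sym fb))[Lg /fine_cvgP[_ fg]].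
apply: nrm_eq0 => d d0; have d2 : 0 < d / 2 by rewrite divr_gt0.
have d4 : 0 < (d / 2) ^+ 2 by rewrite exprn_gt0.
move/cvgrPdist_lt: fg => /(_ _ d4) fg.
have [r [fr [r01 rb]]] := filter_ex (filterI fg (dil_cvg hb d2)).
have gd : nrm (dil r b - toL2 g) < d / 2.
  rewrite ltNge; apply/negP => dg; move: fr; rewrite /= sub0r normrN.
  rewrite (_ : sqint _ = sqint (fun t => ext b (r%:C%C * circ t) - toL2 g t)).
    rewrite sqint_dil_sub//= ger0_norm ?sqr_ge0//; apply/negP; rewrite -leNgt.
    by rewrite ler_pXn2r ?nnegrE ?nrm_ge0// ltW.
  by congr sqint; apply/funext => t; rewrite toL2E.
by refine (nrm_chain2 H _ rb); rewrite (nrm_distrC H).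
Qed.

Lemma geometric_small (K q d : R) : 0 <= q < 1 -> 0 < d ->
  \forall N \near \oo, K * (q ^+ N / (1 - q)) < d.
Proof.
move=> /andP[q0 q1] d0; have q1' : 0 < 1 - q by rewrite subr_gt0.
have h : `|q| < 1 by rewrite ger0_norm.
have K1 : 0 < `|K| + 1 by rewrite ltr_wpDl.
have c0 : 0 < d * (1 - q) / (`|K| + 1) by rewrite divr_gt0// mulr_gt0.
move/cvgrPdist_lt: (cvg_expr h) => /(_ _ c0); apply: filterS => N.
rewrite sub0r normrN ger0_norm ?exprn_ge0// ltr_pdivlMr// => qN.
rewrite mulrA ltr_pdivrMr//; apply: le_lt_trans qN.
by rewrite mulrC ler_wpM2l ?exprn_ge0// (le_trans (ler_norm K))// lerDl.
Qed.

Lemma series_terms_bounded (c : nat -> R[i]) (l : R[i]^o) :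
  series (c : nat -> R[i]^o) @ \oo --> l -> exists K, forall n, cnorm (c n) <= K.
Proof.
move=> /ccvgP /(_ _ ltr01)[N _ cN]; exists (2 + \sum_(n < N) cnorm (c n)) => n.
have S0 : 0 <= \sum_(n < N) cnorm (c n) by apply: sumr_ge0 => i _; exact: cnorm_ge0.
have [nN|Nn] := ltnP n N.
  rewrite (bigD1 (Ordinal nN))//= addrCA lerDl addr_ge0//.
  by apply: sumr_ge0 => i _; exact: cnorm_ge0.
have -> : c n = (series (c : nat -> R[i]^o) n.+1 - l) - (series (c : nat -> R[i]^o) n - l).
  by rewrite opprB addrA subrK seriesEnat /= big_nat_recr//= addrAC subrr add0r.
have := cN _ Nn; have /= := cN n.+1 (leqW Nn).
have := cnormB (series (c : nat -> R[i]^o) n.+1 - l) (series (c : nat -> R[i]^o) n - l).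
by move: (cnorm _) (cnorm _) (cnorm _) => *; lra.
Qed.

(** A power series converges uniformly on smaller circles, so the Fourier
    coefficients there can be read off the series. *)
Lemma analytic_circle (f : R[i] -> R[i]) (a : nat -> R[i]) (r : R) :
  (forall z, disc z -> series (fun n => a n * z ^+ n : R[i]^o) @ \oo --> (f z : R[i]^o)) ->
  0 <= r < 1 -> exists2 F : L2 R, forall t, F t = f (r%:C%C * circ t)
    & forall n, ip F (e n) = a n * r%:C%C ^+ n.
Proof.
move=> af r01; have /andP[r0 r1] := r01.
pose s := (1 + r) / 2.
have s0 : 0 < s by rewrite /s; lra.
have s1 : s < 1 by rewrite /s; lra.
have rs : r < s by rewrite /s; lra.
have ds : disc (s%:C%C : R[i]) by apply/discE; rewrite cnormR ger0_norm// ltW.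
have [K aK] := series_terms_bounded (af _ ds).
pose q := r / s.
have q01 : 0 <= q < 1 by rewrite divr_ge0 ?(ltW s0)//= ltr_pdivrMr// mul1r.
have aq n t : cnorm (a n * (r%:C%C * circ t) ^+ n) <= K * q ^+ n.
  rewrite cnormM cnormX (cnorm_dil r01).
  have -> : r = s * q by rewrite /q mulrC mulfVK// gt_eqF.
  rewrite exprMn mulrA ler_wpM2r ?exprn_ge0//; first by case/andP: q01.
  have := aK n; rewrite cnormM cnormX cnormR ger0_norm//; exact: ltW.
pose S N := \poly_(n < N) (a n * r%:C%C ^+ n).
have SE N t : (S N).[circ t] = \sum_(n < N) a n * (r%:C%C * circ t) ^+ n.
  by rewrite horner_poly; apply: eq_bigr => i _; rewrite exprMn mulrA.
have fS t N : cnorm (f (r%:C%C * circ t) - (S N).[circ t]) <= K * (q ^+ N / (1 - q)).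
  have [l al lN] := dominated_series_cvg q01 (fun n => aq n t).
  have -> : f (r%:C%C * circ t) = l.
    by apply: (cvg_unique (@norm_hausdorff _ R[i]^o) _ al); apply: af; exact: disc_dil.
  by rewrite SE.
pose F : L2 R := toL2 (fun t => f (r%:C%C * circ t)).
have LF : L2_circle (fun t => f (r%:C%C * circ t)).
  apply: (@L2_bounded _ (K * (q ^+ 0 / (1 - q)))).
    apply: (@cmeasurable_cvg _ (fun N t => (S N).[circ t])).
      by move=> n; exact/cmeasurable_horner/cmeasurable_circ.
    move=> t _ d d0; apply: filterS (geometric_small K q01 d0) => N.
    by rewrite cnorm_distrC; exact: le_lt_trans.
  by apply: aeW => t _; have := fS t 0%N; rewrite SE big_ord0 subr0.
have FE t : F t = f (r%:C%C * circ t) by rewrite /F toL2E.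
exists F => // n; apply/eqP; rewrite -subr_eq0; apply/eqP/cnorm0_eq0/eqP.
rewrite eq_le cnorm_ge0 andbT; apply/ler_addgt0Pl => d d0; rewrite addr0.
have [N _ Nd] := geometric_small K q01 d0.
pose m := maxn N n.+1.
have -> : a n * r%:C%C ^+ n = ip (polyL2 (S m)) (e n).
  by rewrite ip_poly coef_poly leq_max ltnSn orbT.
rewrite -(ipBl H) (le_trans (cnorm_coef _ _))//.
apply: (@le_trans _ _ (K * (q ^+ m / (1 - q)))); last first.
  by apply: ltW; apply: Nd; exact: leq_maxl.
apply: nrm_le_sup => [|t]; first by have := le_trans (cnorm_ge0 _) (fS 0 m).
by rewrite L2_subE FE polyL2E fS.
Qed.

Lemma power_series_unique (a : nat -> R[i]) :
  (forall z, disc z -> series (fun n => a n * z ^+ n : R[i]^o) @ \oo --> (0 : R[i]^o)) ->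
  forall n, a n = 0.
Proof.
move=> a0 n; have h : 0 <= (2^-1 : R) < 1.
  by rewrite invr_ge0 ler0n invf_lt1 ?ltr1n.
have [F F0 Fa] := analytic_circle a0 h.
have F00 : F = 0 by apply: L2_eqP => t; rewrite F0.
move: (Fa n); rewrite F00 (ip0l H) => /esym/eqP; rewrite mulf_eq0 => /orP[/eqP//|].
by rewrite expf_eq0 => /andP[_ /eqP/complexI/eqP]; rewrite invr_eq0 pnatr_eq0.
Qed.

(** The Fourier coefficients on the circle of radius [r] are [a n * r ^+ n], so
    Bessel's inequality bounds the sums of [(cnorm (a n) * r ^+ n) ^+ 2]; letting
    [r] tend to one bounds those of [cnorm (a n) ^+ 2], and the Fourier series
    with coefficients [a] converges in [L2]. *)
Lemma H2_hardy (f : R[i] -> R[i]) : H2 f ->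
  exists2 b, hardy b & eq_on_disc f (ext b).
Proof.
move=> [[a af] fy].
have [M fM] : exists M : R, forall r, 0 <= r < 1 ->
    (sqint (fun t => f (r%:C%C * circ t))%R <= M%:E)%E.
  move: fy; rewrite /H2norm; set S := (X in ereal_sup X) => Sy.
  have S_ge r : 0 <= r < 1 -> (sqint (fun t => f (r%:C%C * circ t))%R <= ereal_sup S)%E.
    by move=> r01; apply: ereal_sup_ubound; exists r.
  case: (ereal_sup S) Sy S_ge => [s Sy S_ge|/=|Sy S_ge]; first by exists s.
    by rewrite invr_eq0 pnatr_eq0.
  exists 0 => r r01; apply: le_trans (S_ge r r01) _; exact: leNye.
have key N : \sum_(n < N) cnorm (a n) ^+ 2 <= M.
  apply/ler_addgt0Pl => d d0.
  (* By Bernoulli, replacing r ^ (2 n) by 1 costs at most (1 - r) * K; the radius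
     is taken as 1 - x with x * K <= d. *)
  pose K := \sum_(n < N) cnorm (a n) ^+ 2 * (n + n)%:R.
  have K0 : 0 <= K by apply: sumr_ge0 => n _; rewrite mulr_ge0 ?sqr_ge0.
  have K1 : 0 < K + 1 by rewrite ltr_wpDl.
  pose x := Num.min 1 (d / (K + 1)).
  have x0 : 0 < x by rewrite lt_min ltr01 divr_gt0.
  have x1 : x <= 1 by rewrite ge_min lexx.
  have r01 : 0 <= 1 - x < 1 by rewrite subr_ge0 x1 gtrBl.
  have [F FE Fa] := analytic_circle af r01.
  have FM : nrm F ^+ 2 <= M.
    rewrite -lee_fin -sqintE (_ : L2val F = fun t => f ((1 - x)%:C%C * circ t)).
      exact: fM.
    exact/funext.
  have FB : \sum_(n < N) cnorm (a n * (1 - x)%:C%C ^+ n) ^+ 2 <= M.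
    rewrite -(big_mkord xpredT (fun n => cnorm (a n * (1 - x)%:C%C ^+ n) ^+ 2)).
    under eq_bigr do rewrite -Fa.
    by apply: le_trans FM; apply: (bessel H (@ip_exp R)); exact: iota_uniq.
  have xK : x * K <= d.
    have : x * (K + 1) <= d by rewrite -ler_pdivlMr// ge_min lexx orbT.
    by rewrite mulrDr mulr1 => /(le_trans _); apply; rewrite lerDl ltW.
  rewrite addrC; apply: le_trans (lerD FB xK).
  rewrite mulr_sumr -big_split /=; apply: ler_sum => n _.
  rewrite cnormM cnormX cnormR ger0_norm; last by case/andP: r01.
  rewrite exprMn -exprM mulnC mul2n -addnn mulrCA -mulrDr ler_peMr ?sqr_ge0//.
  have := bernoulli_le r01 (n + n).
  have -> : 1 - (1 - x) = x by rewrite opprB addrC subrK.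
  by rewrite lerBlDr addrC [x * _]mulrC.
have [b [ba bS]] := orthonormal_series_cvg H (@L2_complete R) (@ip_exp R) key.
exists b.
  move=> d /bS[N bN]; exists (\poly_(n < N) a n); move: bN; congr (nrm (_ - _) < d).
  by rewrite poly_def polyL2_sum; apply: eq_bigr => i _; rewrite polyL2Z.
move=> z dz; have [bz _] := ext_spec b dz.
apply: (cvg_unique (@norm_hausdorff _ R[i]^o) (af z dz)).
suff <- : (fun n => ip b (e n) * z ^+ n : R[i]^o) = (fun n => a n * z ^+ n : R[i]^o).
  by [].
by apply/funext => n; rewrite ba.
Qed.

End HardyBoundary.

(** * Analytic and coanalytic parts *)

Section RieszProjection.
Variable R : realType.
Local Notation mu := (@lebesgue_measure R).
Local Notation D := [set` `[0%R : R, 1%R]].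
Local Notation nrm := (nrm (@ip R)).
Local Notation e n := (polyL2 ('X^n : {poly R[i]})).
Let H := @semi_inner_ip R.
Implicit Types b h u x y : L2 R.

Lemma hardy_null b c : hardy c -> nrm (b - c) = 0 -> hardy b.
Proof. by move=> hc bc; apply: hardy_closed => d d0; exists c => //; rewrite bc. Qed.

Lemma ext_null b c z : nrm (b - c) = 0 -> disc z -> ext b z = ext c z.
Proof.
move=> bc dz; apply/eqP; rewrite -subr_eq0 -extB//; apply/eqP/cnorm0_eq0/eqP.
rewrite eq_le cnorm_ge0 andbT; have [_] := ext_spec (b - c) dz.
by rewrite bc mul0r.
Qed.

Lemma nrm0_ae b c : nrm (b - c) = 0 -> {ae mu, forall t, D t -> b t = c t}.
Proof.
move=> bc; have bc0 : (\int[mu]_(t in D) `|(cnorm (b t - c t)%R ^+ 2)%:E| = 0)%E.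
  transitivity (sqint (b - c)%R); last by rewrite sqintE bc expr0n.
  by apply: eq_integral => t _; rewrite gee0_abs// lee_fin sqr_ge0.
have m : measurable_fun D (fun t => (cnorm (b t - c t) ^+ 2)%:E).
  exact: (measurable_cnorm_sqr (L2_meas (b - c))).
have ae0 : {ae mu, forall t, D t -> (cnorm (b t - c t)%R ^+ 2)%:E = 0%E}.
  by apply: (ae_eq_integral_abs _ _ _).1.
refine (ae_imply ae0 _) => t bt Dt; apply/eqP; rewrite -subr_eq0.
have [/eqP] := bt Dt; rewrite expf_eq0 /= => /eqP bt0.
exact/eqP/cnorm0_eq0.
Qed.

Lemma ext_at0 b : ext b 0 = ip b (e 0).
Proof.
rewrite extE; apply: (@cvg_lim R[i]^o); first exact: norm_hausdorff.
apply: (@cvg_near_cst _ R[i]^o); exists 1%N => // n /= n0.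
rewrite /series /= big_ltn// big_nat_cond big1; first by rewrite expr0 mulr1 addr0.
by move=> i /andP[/andP[i0 _] _]; rewrite expr0n gtn_eqF// mulr0.
Qed.

Lemma conjL2_exp0 : conjL2 (e 0) = e 0.
Proof. by apply: L2_eqP => t; rewrite conjL2E !polyL2E hornerXn expr0 conjc1. Qed.

Lemma ip_conjL2 x y : ip (conjL2 x) y = conjc (ip x (conjL2 y)).
Proof.
rewrite -(ip_conj H) !ipE; apply: eq_cint => t _; rewrite !conjL2E.
by rewrite mulrC.
Qed.

Lemma hardy_ip_conj h n : hardy h -> ip h (conjL2 (e n.+1)) = 0.
Proof.
move=> hh; apply: (ip_eq0_closure H) => d /hh[p hp]; exists (polyL2 p) => //.
rewrite polyL2_coef (ip_suml H) big1// => i _.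
by rewrite (ipZl H) ip_exp_conj mulr0.
Qed.

Lemma ess_bounded_conj_circ N : ess_bounded 1 (fun t : R => conjc (circ t) ^+ N).
Proof.
apply: ess_boundedW => [|t]; last by rewrite cnormX cnormJ cnorm_circ expr1n.
have := cmeasurable_horner 'X^N (cmeasurableJ (@cmeasurable_circ R)).
by congr cmeasurable; apply/funext => t; rewrite hornerXn.
Qed.

Lemma circ_conjX m n (t : R) : (m <= n)%N ->
  conjc (circ t) ^+ n * circ t ^+ m = conjc (circ t) ^+ (n - m).
Proof.
move=> mn; rewrite -[in LHS](subnK mn) exprD -mulrA -exprMn mulrC.
by rewrite [conjc _ * _]mulrC circJ expr1n mul1r.
Qed.

(** A Laurent polynomial is the sum of its nonnegative and its negative
    frequencies; taking off the latter is the projection used in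
    [hardy_of_laurent]. *)
Lemma laurent_split N (r : {poly R[i]}) :
  mulL2 (fun t : R => conjc (circ t) ^+ N) (polyL2 r) =
  polyL2 (drop_poly N r) + \sum_(i < N) r`_i *: conjL2 (e (N - i)).
Proof.
apply: L2_eqP => t; rewrite (mulL2E _ _ (ess_bounded_conj_circ N)) L2_addE !polyL2E.
have -> : L2val (\sum_(i < N) r`_i *: conjL2 (e (N - i))) t =
    \sum_(i < N) r`_i * conjc (circ t) ^+ (N - i).
  elim/big_rec2: _ => [//|i y1 y2 _ <-]; rewrite L2_addE L2_scaleE conjL2E polyL2E.
  by rewrite hornerXn conjcX.
rewrite -[r in LHS](poly_take_drop N) hornerD hornerM hornerXn mulrDr addrC.
congr (_ + _); first by rewrite mulrCA circ_conjX// subnn mulr1.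
rewrite horner_poly mulr_sumr; apply: eq_bigr => i _.
by rewrite mulrCA circ_conjX// ltnW.
Qed.

(** When [u] has no negative frequencies, dropping those of a Laurent polynomial
    only brings it closer to [u], by Pythagoras. *)
Lemma hardy_of_laurent u :
  (forall m, ip u (conjL2 (e m.+1)) = 0) ->
  (forall d, 0 < d -> exists N r,
     nrm (u - mulL2 (fun t : R => conjc (circ t) ^+ N) (polyL2 r)) < d) ->
  hardy u.
Proof.
move=> u0 ua d /ua[N [r ur]]; exists (drop_poly N r); move: ur.
rewrite laurent_split; set p := polyL2 _; set q := \sum_(i < N) _.
have hp : hardy p by exact: hardy_poly.
clearbody p => ur; apply: le_lt_trans ur.
apply: ler_of_sqr; first exact: nrm_ge0.
have -> : u - (p + q) = (u - p) + - q by rewrite opprD addrA.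
have pq : ip (u - p) (- q) = 0.
  rewrite (ipNr H) (ip_conj H) (ip_suml H) big1 ?conjc0 ?oppr0// => i _.
  rewrite (ipZl H) (ip_conj H) -(subnSK (ltn_ord i)) (ipBl H) u0 hardy_ip_conj//.
  by rewrite subrr conjc0 mulr0.
by rewrite (pythagoras H pq) lerDl sqr_ge0.
Qed.

(** On the circle, where [conj z = z^-1], the conjugate of a polynomial [p] is
    [z ^- size p] times this polynomial. *)
Definition conj_rev (p : {poly R[i]}) : {poly R[i]} :=
  \sum_(i < size p) conjc p`_i *: 'X^(size p - i).

Lemma horner_conj_rev (p : {poly R[i]}) (t : R) :
  conjc p.[circ t] = conjc (circ t) ^+ size p * (conj_rev p).[circ t].
Proof.
rewrite horner_coef conjc_sum /conj_rev horner_sum mulr_sumr.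
apply: eq_bigr => i _; rewrite hornerZ hornerXn conjcM conjcX mulrCA.
rewrite circ_conjX ?leq_subr// subKn//; exact: ltnW.
Qed.

End RieszProjection.

(** * Multiplication by an inner function and its model space *)

Lemma ae_imply2 (R : realType) (P Q S : R -> Prop) :
  {ae @lebesgue_measure R, forall t, P t} -> {ae @lebesgue_measure R, forall t, Q t} ->
  (forall t, P t -> Q t -> S t) -> {ae @lebesgue_measure R, forall t, S t}.
Proof.
move=> hP hQ PQ; apply: (negligibleS _ (negligibleU hP hQ)) => t /= nS.
by apply: contrapT => /not_orP[/contrapT Pt /contrapT Qt]; exact/nS/PQ.
Qed.

Section InnerMultiplication.
Variable R : realType.
Local Notation mu := (@lebesgue_measure R).
Local Notation D := [set` `[0%R : R, 1%R]].
Local Notation nrm := (nrm (@ip R)).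
Local Notation e n := (polyL2 ('X^n : {poly R[i]})).
Let H := @semi_inner_ip R.
Implicit Types b h u x y : L2 R.

Lemma H2_boundary_hardy (f : R[i] -> R[i]) (g : R -> R[i]) :
  H2 f -> boundary_function f g -> hardy (toL2 g) /\ eq_on_disc f (ext (toL2 g)).
Proof.
move=> /H2_hardy[b hb fb] fg; have gb := boundary_unique hb fb fg.
split; first exact: hardy_null hb gb.
by move=> z dz; rewrite fb// (ext_null gb).
Qed.

Lemma inner_H2 (theta : R[i] -> R[i]) : inner_function theta -> H2 theta.
Proof.
move=> [[a ta] [M tM] _]; split; first by exists a.
have M0 : 0 <= M.
  by apply: le_trans (tM 0 _); [exact: cnorm_ge0|apply/discE; rewrite cnorm0].
have : (ereal_sup [set sqint (fun t => theta (r%:C%C * circ t)%R)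
       | r in [set r : R | (0 <= r < 1)%R]] <= (M ^+ 2)%:E)%E.
  apply: ge_ereal_sup => _ [r /= r01 <-]; have [F FE _] := analytic_circle ta r01.
  rewrite (_ : (fun t => _) = L2val F); last by apply/funext => t; rewrite FE.
  rewrite sqintE lee_fin ler_pXn2r ?nnegrE ?nrm_ge0//.
  by apply: nrm_le_sup => // t; rewrite FE; apply/tM/disc_dil.
rewrite /H2norm; case: ereal_sup => [s _| |] //=; rewrite ?ltry//.
by rewrite ?invr_eq0 ?pnatr_eq0/= ?ltry.
Qed.

Variables (theta : R[i] -> R[i]) (tb : R -> R[i]).
Hypothesis inner : inner_function theta.
Hypothesis tb_boundary : boundary_function theta tb.
Hypothesis tb1 : {ae mu, forall t, D t -> cnorm (tb t) = 1}.

Let T : L2 R := toL2 tb.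
Local Notation W := (mulL2 tb).

Let TE : T = tb :> (R -> R[i]^o).
Proof. by rewrite /T toL2E//; case: tb_boundary. Qed.

Let hT : hardy T.
Proof. by have [] := H2_boundary_hardy (inner_H2 inner) tb_boundary. Qed.

Let extT z : disc z -> theta z = ext T z.
Proof. by have [_] := H2_boundary_hardy (inner_H2 inner) tb_boundary; exact. Qed.

Lemma inner_ess_bounded : ess_bounded 1 tb.
Proof.
split; first by rewrite -TE; exact: L2_meas.
by refine (ae_imply tb1 _) => t t1 /t1 ->.
Qed.
Let tb_bounded := inner_ess_bounded.

Lemma ip_W x y : ip (W x) (W y) = ip x y.
Proof. exact: ip_mulL2_unimodular tb_bounded tb1. Qed.

Lemma nrm_W x : nrm (W x) = nrm x.
Proof.
by apply/eqP; rewrite -(@eqrXn2 _ 2) ?nrm_ge0// !(nrm_sqr H) ip_W.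
Qed.

Lemma WB x y : W (x - y) = W x - W y.
Proof. exact: mulL2B tb_bounded. Qed.

Lemma W0 : W 0 = 0.
Proof. by rewrite -[0 in LHS](subrr 0) WB subrr. Qed.

Lemma W_poly (p : {poly R[i]}) : W (polyL2 p) = mulL2 (fun t => p.[circ t]) T.
Proof.
apply: L2_eqP => t; rewrite (mulL2E _ _ tb_bounded).
by rewrite (mulL2E _ _ (ess_bounded_horner p)) polyL2E TE mulrC.
Qed.

Let poly_bound_ge0 (p : {poly R[i]}) : 0 <= poly_bound p.
Proof. by apply: sumr_ge0 => i _; exact: cnorm_ge0. Qed.

Let W_poly_approx (p q : {poly R[i]}) :
  nrm (W (polyL2 p) - polyL2 (p * q)) <= poly_bound p * nrm (T - polyL2 q).
Proof.
rewrite W_poly polyL2M -(mulL2B _ _ (ess_bounded_horner p)).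
exact: nrm_mulL2 (ess_bounded_horner p) (poly_bound_ge0 p).
Qed.

Lemma hardy_W_poly (p : {poly R[i]}) : hardy (W (polyL2 p)).
Proof.
apply: hardy_closed => d d0.
have p1 : 0 < poly_bound p + 1 by rewrite ltr_wpDl.
have [q Tq] := hT (divr_gt0 d0 p1).
exists (polyL2 (p * q)); first exact: hardy_poly.
apply: le_lt_trans (W_poly_approx p q) _.
apply: (@le_lt_trans _ _ ((poly_bound p + 1) * nrm (T - polyL2 q))).
  by rewrite ler_wpM2r ?nrm_ge0// lerDl.
by rewrite mulrC -ltr_pdivlMr.
Qed.

Lemma hardy_W h : hardy h -> hardy (W h).
Proof.
move=> hh; apply: hardy_closed => d /hh[p hp]; exists (W (polyL2 p)).
  exact: hardy_W_poly.
by rewrite -WB nrm_W.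
Qed.

Let cnorm_small0 (z : R[i]) (k : R) :
  (forall d, 0 < d -> cnorm z <= k * d) -> z = 0.
Proof.
move=> zk; apply: cnorm0_eq0; apply/eqP; rewrite eq_le cnorm_ge0 andbT.
apply/ler_addgt0Pl => d d0; rewrite addr0.
have k1 : 0 < `|k| + 1 by rewrite ltr_wpDl.
apply: le_trans (zk _ (divr_gt0 d0 k1)) _; rewrite mulrA ler_pdivrMr// mulrC.
by rewrite ler_wpM2l ?(ltW d0)// (le_trans (ler_norm k))// lerDl.
Qed.

Let ext_W_poly (p : {poly R[i]}) z : disc z -> ext (W (polyL2 p)) z = theta z * p.[z].
Proof.
move=> dz; have z1 : 0 < 1 - cnorm z by rewrite subr_gt0; exact/discE.
apply/eqP; rewrite -subr_eq0; apply/eqP.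
apply: (@cnorm_small0 _ ((poly_bound p + cnorm p.[z]) / (1 - cnorm z))) => d d0.
have [q Tq] := hT d0.
have -> : ext (W (polyL2 p)) z - theta z * p.[z] =
    ext (W (polyL2 p) - polyL2 (p * q)) z - p.[z] * ext (T - polyL2 q) z.
  by rewrite !extB// !ext_poly hornerM extT//; ring.
have [_ h1] := ext_spec (W (polyL2 p) - polyL2 (p * q)) dz.
have [_ h2] := ext_spec (T - polyL2 q) dz.
apply: le_trans (cnormB _ _) _; rewrite mulrAC mulrDl mulrDl cnormM.
apply: lerD.
  apply: le_trans h1 _; rewrite ler_pM2r ?invr_gt0//.
  by apply: le_trans (W_poly_approx p q) _; rewrite ler_wpM2l// ltW.
rewrite -mulrA ler_wpM2l ?cnorm_ge0//; apply: le_trans h2 _.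
by rewrite ler_pM2r ?invr_gt0// ltW.
Qed.

(** Both sides depend continuously on [h] and agree on polynomials, where [tb]
    in turn is approximated by polynomials. *)
Lemma ext_W h z : hardy h -> disc z -> ext (W h) z = theta z * ext h z.
Proof.
move=> hh dz; have z1 : 0 < 1 - cnorm z by rewrite subr_gt0; exact/discE.
apply/eqP; rewrite -subr_eq0; apply/eqP.
apply: (@cnorm_small0 _ ((1 + cnorm (theta z)) / (1 - cnorm z))) => d d0.
have [p hp] := hh _ d0.
have -> : ext (W h) z - theta z * ext h z =
    ext (W (h - polyL2 p)) z - theta z * ext (h - polyL2 p) z.
  by rewrite WB !extB// ext_W_poly// ext_poly; ring.
have [_ h1] := ext_spec (W (h - polyL2 p)) dz; rewrite nrm_W in h1.
have [_ h2] := ext_spec (h - polyL2 p) dz.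
have hp' : nrm (h - polyL2 p) / (1 - cnorm z) <= d / (1 - cnorm z).
  by rewrite ler_pM2r ?invr_gt0// ltW.
apply: le_trans (cnormB _ _) _; rewrite mulrAC mulrDl mulrDl cnormM mul1r.
apply: lerD; first exact: le_trans h1 hp'.
by rewrite -mulrA ler_wpM2l ?cnorm_ge0//; exact: le_trans h2 hp'.
Qed.

(** Orthogonality to [theta] times the polynomials.  This is the model space, by
    [model_space_ext] and [model_space_coinvariant]. *)
Definition coinvariant b : Prop := hardy b /\ forall n, ip b (W (e n)) = 0.

Lemma W_sum (c : nat -> R[i]) n :
  W (\sum_(i < n) c i *: e i) = \sum_(i < n) c i *: W (e i).
Proof.
elim: n => [|n IH]; first by rewrite !big_ord0 W0.
rewrite !big_ord_recr /= addrC (mulL2_linear _ _ _ tb_bounded) IH.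
by rewrite addrC.
Qed.

Lemma coinvariant_ip b h : coinvariant b -> hardy h -> ip b (W h) = 0.
Proof.
move=> [_ b0] hh; rewrite (ip_conj H).
suff -> : ip (W h) b = 0 by rewrite conjc0.
apply: (ip_eq0_closure H) => d /hh[p hp]; exists (W (polyL2 p)); last first.
  by rewrite -WB nrm_W.
rewrite polyL2_coef (W_sum (fun i => p`_i)) (ip_suml H) big1// => i _.
by rewrite (ipZl H) (ip_conj H) b0 conjc0 mulr0.
Qed.

(** The coefficient of [tb * conj b] at frequency [-m] is the conjugate of the
    inner product of [b] with [theta z^m], which vanishes.  Approximating [b] and
    [tb] by polynomials approximates [tb * conj b] by Laurent polynomials, so
    [hardy_of_laurent] applies. *)
Lemma hardy_companion b : coinvariant b -> hardy (W (conjL2 b)).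
Proof.
move=> [hb b0]; apply: hardy_of_laurent => [m|d d0].
  have -> : ip (W (conjL2 b)) (conjL2 (e m.+1)) = conjc (ip b (W (e m.+1))).
    rewrite -(ip_conj H) !ipE; apply: eq_cint => t _.
    rewrite !(mulL2E _ _ tb_bounded) !conjL2E conjcK; ring.
  by rewrite b0 conjc0.
have d2 : 0 < d / 2 by rewrite divr_gt0.
have [p bp] := hb _ d2.
have p1 : 0 < poly_bound p + 1 by rewrite ltr_wpDl.
have [q Tq] := hT (divr_gt0 d2 p1).
exists (size p), (conj_rev p * q).
have bc := ess_bounded_conj (ess_bounded_horner p).
have E1 : W (conjL2 (polyL2 p)) = mulL2 (fun t => conjc p.[circ t]) T.
  apply: L2_eqP => t; rewrite (mulL2E _ _ tb_bounded) (mulL2E _ _ bc).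
  by rewrite conjL2E polyL2E TE mulrC.
have E2 : mulL2 (fun t : R => conjc (circ t) ^+ size p) (polyL2 (conj_rev p * q)) =
    mulL2 (fun t => conjc p.[circ t]) (polyL2 q).
  apply: L2_eqP => t; rewrite (mulL2E _ _ bc) (mulL2E _ _ (ess_bounded_conj_circ _ _)).
  by rewrite !polyL2E hornerM mulrA -horner_conj_rev.
rewrite E2; apply: (nrm_chain2 H (y := W (conjL2 (polyL2 p)))).
  by rewrite -WB nrm_W -conjL2B nrm_conjL2.
rewrite E1 -(mulL2B _ _ bc).
apply: le_lt_trans (nrm_mulL2 _ bc (poly_bound_ge0 p)) _.
apply: (@le_lt_trans _ _ ((poly_bound p + 1) * nrm (T - polyL2 q))).
  by rewrite ler_wpM2r ?nrm_ge0// lerDl.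
by rewrite mulrC -ltr_pdivlMr.
Qed.

(** The companion is [tb * conj b]; its value at the origin is the frequency
    zero coefficient, the conjugate of the inner product of [b] with
    [theta]. *)
Lemma model_space_ext b : coinvariant b -> model_space theta (ext b).
Proof.
move=> cb; have [hb b0] := cb; have hu := hardy_companion cb.
split; first exact: H2_ext.
exists (ext (W (conjL2 b))).
  split; first exact: H2_ext.
  rewrite ext_at0 -conjL2_exp0.
  have -> : ip (W (conjL2 b)) (conjL2 (e 0)) = conjc (ip b (W (e 0))).
    rewrite -(ip_conj H) !ipE; apply: eq_cint => t _.
    rewrite !(mulL2E _ _ tb_bounded) !conjL2E conjcK; ring.
  by rewrite b0 conjc0.
exists b, tb, (W (conjL2 b)).
split; [exact: hardy_boundary|exact: tb_boundary|exact: hardy_boundary|].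
refine (ae_imply tb1 _) => t t1 /t1 tt1; rewrite (mulL2E _ _ tb_bounded) conjL2E.
by rewrite conjcM conjcK mulrA mulcJ tt1 expr1n mul1r.
Qed.

Lemma model_space_eq (f g : R[i] -> R[i]) : eq_on_disc f g ->
  model_space theta g -> model_space theta f.
Proof.
move=> fg [H2g [h hh [gb [thb [hb [bg bt bh gt]]]]]].
split; first exact: H2_eq H2g.
exists h => //; exists gb, thb, hb.
by split; [exact: boundary_function_eq bg|exact: bt|exact: bh|exact: gt].
Qed.

(** On the circle [b = tb * conj h] with [h] analytic and [h 0 = 0], so the inner
    product with [theta z^n] is that of [conj h] with [z^n], because [tb] has
    modulus one; it vanishes by frequencies. *)
Lemma model_space_coinvariant (f : R[i] -> R[i]) b : hardy b ->
  eq_on_disc f (ext b) -> model_space theta f -> coinvariant b.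
Proof.
move=> hb fb [H2f [h [H2h h0] [fb' [tb' [hb' [bf bt bh eq_ae]]]]]].
split=> // n.
have fb0 := boundary_unique hb fb bf.
have [hh hE] := H2_boundary_hardy H2h bh.
have tt : {ae mu, forall t, D t -> toL2 tb' t = T t}.
  by apply: nrm0_ae; apply: (boundary_unique hT extT bt).
pose X := W (conjL2 (toL2 hb')).
have Xf : {ae mu, forall t, D t -> X t = toL2 fb' t}.
  refine (ae_imply2 tt eq_ae _) => t tt' fE Dt.
  have [Lf Lt Lh] : [/\ L2_circle fb', L2_circle tb' & L2_circle hb'].
    by split; [case: bf|case: bt|case: bh].
  rewrite (mulL2E _ _ tb_bounded) conjL2E -TE -(tt' Dt).
  by rewrite (toL2E Lf) (toL2E Lt) (toL2E Lh) fE.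
have Xb : nrm (X - b) = 0.
  apply/eqP; rewrite eq_le nrm_ge0 andbT.
  by have := nrmB_le H X (toL2 fb') b; rewrite (ae_nrm0 Xf) fb0 addr0.
have -> : ip b (W (e n)) = ip X (W (e n)).
  by apply/esym/eqP; rewrite -subr_eq0 -(ipBl H) (ip_null_l H).
rewrite ip_W ip_conjL2; case: n => [|n]; last by rewrite hardy_ip_conj// conjc0.
rewrite conjL2_exp0 -ext_at0 -hE ?h0 ?conjc0//.
by apply/discE; rewrite cnorm0.
Qed.

(** The functions [W (e n)] are orthonormal, so Bessel and Riesz-Fischer give an
    [h] with coefficients [ip g (W (e n))], and [W h] is the projection of [g]
    to [theta] times the Hardy space. *)
Lemma model_decomposition g : hardy g ->
  exists2 h, hardy h & coinvariant (g - W h).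
Proof.
move=> hg.
have W_on i j : ip (W (e i)) (W (e j)) = (i == j)%:R by rewrite ip_W ip_exp.
have key N : \sum_(n < N) cnorm (ip g (W (e n))) ^+ 2 <= nrm g ^+ 2.
  rewrite -(big_mkord xpredT (fun n => cnorm (ip g (W (e n))) ^+ 2)).
  by apply: (bessel H W_on); exact: iota_uniq.
have [h [hE hS]] := @orthonormal_series_cvg _ _ _ H (@L2_complete R) _
  (fun n => ip g (W (e n))) _ (@ip_exp R) key.
have hh : hardy h.
  move=> d /hS[N hN]; exists (\poly_(n < N) ip g (W (e n))).
  move: hN; congr (nrm (_ - _) < d).
  by rewrite poly_def polyL2_sum; apply: eq_bigr => i _; rewrite polyL2Z.
exists h => //; split; first by apply: hardyB => //; exact: hardy_W.
by move=> n; rewrite (ipBl H) ip_W hE subrr.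
Qed.

End InnerMultiplication.

(** * Weak-star closures of subspaces of the dual *)

Section WeakStarClosure.
Variables (R : realType) (V : lmodType R[i]).
Implicit Types (f g : V -> R[i]) (A : set (V -> R[i])).

Definition linear_functional f : Prop :=
  forall a x y, f (a *: x + y) = a * f x + f y.

Lemma linear_functional0 f : linear_functional f -> f 0 = 0.
Proof.
move=> lf; have := lf 1 0 0; rewrite scale1r addr0 mul1r => /eqP.
by rewrite -subr_eq0 opprD addrA subrr add0r oppr_eq0 => /eqP.
Qed.

(** Finite-dimensional duality, by induction on the points.  If some [g1] in [A]
    takes the value one at the first point, then subtracting a multiple of [g1]
    reduces to functionals vanishing there; otherwise that point lies in the
    common kernel. *)
Lemma bipolar_interpolation (s : seq V) A f :
  A (fun=> 0) -> (forall a g h, A g -> A h -> A (fun x => a * g x + h x)) ->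
  (forall g, A g -> linear_functional g) -> linear_functional f ->
  (forall x, (forall g, A g -> g x = 0) -> f x = 0) ->
  exists2 g, A g & {in s, forall x, g x = f x}.
Proof.
elim: s A f => [|x0 s IH] A f A0 Alin Afun flin fker; first by exists (fun=> 0).
have [allx0|/existsNP[g0 /not_implyP[Ag0 g0x]]] := pselect (forall g, A g -> g x0 = 0).
  have [g Ag gs] := IH A f A0 Alin Afun flin fker; exists g => // x.
  by rewrite inE => /orP[/eqP->|/gs//]; rewrite allx0// fker.
pose g1 x := (g0 x0)^-1 * g0 x.
have Ag1 : A g1.
  have -> : g1 = fun x => (g0 x0)^-1 * g0 x + 0.
    by apply/funext => x; rewrite addr0.
  exact: Alin.
have g1x0 : g1 x0 = 1 by rewrite /g1 mulVf//; exact/eqP.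
(* Replacing x by x - g1 x *: x0 turns the common kernel of A' into that of A. *)
pose A' := [set g | A g /\ g x0 = 0].
pose f' x := - f x0 * g1 x + f x.
have Aker g x : A g -> (forall h, A' h -> h x = 0) -> g x = g x0 * g1 x.
  move=> Ag xA'; have : A' (fun y => - g x0 * g1 y + g y).
    by split; [exact: Alin|rewrite g1x0 mulr1 addNr].
  by move=> /xA' /eqP; rewrite mulNr addrC subr_eq0 => /eqP.
have [|||||g [Ag gx0] gs] := IH A' f'.
- by split.
- move=> a g h [Ag gx0] [Ah hx0]; split; first exact: Alin.
  by rewrite gx0 hx0 mulr0 addr0.
- by move=> g [Ag _]; exact: Afun.
- by move=> a x y; rewrite /f' flin (Afun _ Ag1); ring.
- move=> x xA'; have : f (- g1 x *: x0 + x) = 0.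
    apply: fker => g Ag; rewrite (Afun g Ag) (Aker g x Ag xA'); ring.
  by rewrite flin /f' => <-; ring.
exists (fun x => f x0 * g1 x + g x); first exact: Alin.
move=> x; rewrite inE => /orP[/eqP->|xs]; first by rewrite gx0 g1x0 mulr1 addr0.
by rewrite (gs x xs) /f'; ring.
Qed.

End WeakStarClosure.

Section PointwiseClosure.
Variables (R : realType) (X : normedModType R[i]).

(** A neighbourhood for pointwise convergence constrains finitely many points
    only. *)
Lemma interpolation_closure (A : set {ptws X -> R[i]^o}) (f : {ptws X -> R[i]^o}) :
  (forall s : seq X, exists2 g, A g & {in s, forall x, g x = f x}) -> closure A f.
Proof.
move=> interp.
pose B (s : seq X) := [set g : {ptws X -> R[i]^o} | A g /\ {in s, forall x, g x = f x}].
pose F := filter_from [set: seq X] B.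
have FF : ProperFilter F.
  apply: filter_from_proper; last first.
    by move=> s _; have [g Ag gs] := interp s; exists g.
  apply: filter_from_filter; first by exists [::].
  move=> s1 s2 _ _; exists (s1 ++ s2) => // g [Ag gs].
  by split; split=> // x xs; apply: gs; rewrite mem_cat xs ?orbT.
rewrite closureEcvg; exists F => //; split; last first.
  by move=> S AS; exists [::] => // g [Ag _]; exact: AS.
apply/pointwise_cvgP => x; apply: cvg_near_cst.
by exists [:: x] => // g [_ gx] /=; rewrite gx// inE.
Qed.

Lemma closure_eval (A : set {ptws X -> R[i]^o}) (f : {ptws X -> R[i]^o}) (x : X) :
  closure A f -> (forall g, A g -> g x = 0) -> f x = 0.
Proof.
move=> Af A0; apply: contrapT => fx0.
have c : {for f, continuous (fun g : {ptws X -> R[i]^o} => g x)}.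
  exact: (@proj_continuous X (fun=> R[i]^o) x).
have n : nbhs (f x) (fun z : R[i]^o => z != 0).
  have f0 : 0 < cnorm (f x).
    by rewrite lt_def cnorm_ge0 andbT; apply/eqP => /cnorm0_eq0.
  have idc : (id : R[i]^o -> R[i]^o) z @[z --> f x] --> f x by exact: cvg_id.
  apply: filterS ((ccvgP (nbhs_filter _) _ _).1 idc _ f0) => z.
  by apply: contraTN => /eqP->; rewrite sub0r cnormN ltxx.
have [g [Ag /=]] := Af _ (c _ n).
by rewrite A0// eqxx.
Qed.

End PointwiseClosure.

Section Dual.
Variables (R : realType) (X : completeNormedModType R[i]).

Lemma normrnorm (x : X) : `|x| = (rnorm x)%:C%C.
Proof.
rewrite /rnorm; have := normr_ge0 x; case: `|x| => a b.
by rewrite lecE /= => /andP[/eqP->].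
Qed.

Lemma rnorm_ge0 (x : X) : 0 <= rnorm x.
Proof. by rewrite -ler0c -normrnorm normr_ge0. Qed.

Lemma dual_of_bounded (f : X -> R[i]^o) (c : R) :
  (forall a x y, f (a *: x + y) = a * f x + f y) ->
  (forall x, cnorm (f x) <= c * rnorm x) -> dual (f : {ptws X -> R[i]^o}).
Proof.
move=> flin fc.
have lf : linear f by move=> a x y; rewrite flin.
pose l : {linear X -> R[i]^o} := HB.pack f (GRing.isLinear.Build _ _ _ _ f lf).
exists l => //; apply: bounded_linear_continuous; apply/linear_boundedP.
have c0 : 0 <= `|c| by [].
near=> r => x.
have -> : `|l x| = (cnorm (f x))%:C%C.
  apply/eqP; rewrite eq_complex /= eqxx/=.
  by apply/eqP; exact: (congr1 (@complex.Im R) (normc_def (f x))).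
apply: (@le_trans _ _ (`|c|%:C%C * `|x|)).
  rewrite normrnorm -rmorphM lecR (le_trans (fc x))//.
  by rewrite ler_wpM2r ?rnorm_ge0// ler_norm.
rewrite ler_wpM2r//; near: r; apply: nbhs_pinfty_ge.
by apply: ger0_real; rewrite ler0c.
Unshelve. all: by end_near. Qed.

Lemma dual_bounded (L : {ptws X -> R[i]^o}) : dual L ->
  (forall a x y, L (a *: x + y) = a * L x + L y) /\
  exists2 c, 0 <= c & forall x, cnorm (L x) <= c * rnorm x.
Proof.
move=> [l lc ->]; split; first by move=> a x y; rewrite linearP.
have /linear_boundedP/pinfty_ex_gt0[M M0 lM] := (continuous_linear_bounded 0 (lc 0)).
exists (complex.Re M); first by move: M0; rewrite ltcE /= => /andP[_ /ltW].
move=> x; have := lM x; rewrite normrnorm lecE /= => /andP[_].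
move: M0; rewrite ltcE /= => /andP[/eqP M0 _].
by rewrite cReM /= mulr0 subr0 cnormE.
Qed.

Lemma bounded_eq_dense (f g : X -> R[i]^o) (c d : R) (S : set X) : dense S ->
  0 <= c -> 0 <= d ->
  (forall a x y, f (a *: x + y) = a * f x + f y) ->
  (forall a x y, g (a *: x + y) = a * g x + g y) ->
  (forall x, cnorm (f x) <= c * rnorm x) -> (forall x, cnorm (g x) <= d * rnorm x) ->
  (forall x, S x -> f x = g x) -> f = g.
Proof.
move=> dS c0 d0 flin glin fc gd fg; apply/funext => x.
apply/eqP; rewrite -subr_eq0; apply/eqP/cnorm0_eq0/eqP; rewrite eq_le cnorm_ge0 andbT.
apply/ler_addgt0Pl => e e0; rewrite addr0.
have cd : 0 < c + d + 1 by rewrite ltr_wpDl ?addr_ge0.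
have e1 : 0 < e / (c + d + 1) by rewrite divr_gt0.
have e2 : 0 < (e / (c + d + 1))%:C%C by rewrite ltcR.
have [||y [/interior_subset xy Sy]] := dS (ball x (e / (c + d + 1))%:C%C)°.
- by exists x; exact: (nbhsx_ballx x _ e2).
- exact: open_interior.
have rxy : rnorm (x - y) < e / (c + d + 1).
  by move: xy; rewrite -ball_normE /ball_ /= normrnorm ltcR.
have sub (h : X -> R[i]^o) : (forall a u v, h (a *: u + v) = a * h u + h v) ->
    h x = h (x - y) + h y.
  by move=> hlin; rewrite -[x - y]scale1r -[in RHS](mul1r (h _)) -hlin !scale1r subrK.
rewrite (sub f flin) (sub g glin) (fg _ Sy) opprD addrACA subrr addr0.
apply: le_trans (cnormB _ _) _; apply: le_trans (lerD (fc _) (gd _)) _.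
rewrite -mulrDl; apply: (@le_trans _ _ ((c + d + 1) * rnorm (x - y))).
  by rewrite ler_wpM2r ?rnorm_ge0// lerDl.
by rewrite mulrC -ler_pdivlMr// ltW.
Qed.

End Dual.

(** * The Cauchy dual *)

Section RootTest.
Variable R : realType.

Lemma limn_esup_lt (u : nat -> \bar R) (x : \bar R) : (limn_esup u < x)%E ->
  exists N, forall n, (N <= n)%N -> (u n < x)%E.
Proof.
rewrite limn_esup_lim (cvg_lim _ (@cvg_esups_inf R u))// => /ereal_inf_lt[_ [N _ <-] Nx].
exists N => n Nn; apply: le_lt_trans Nx; apply: ereal_sup_ubound.
by exists n.
Qed.

Lemma root_test_bound (a : nat -> R) (q : R) : 1 < q -> (forall n, 0 <= a n) ->
  (limn_esup (fun n => (a n `^ n%:R^-1)%:E) <= 1)%E ->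
  exists N, forall n, (N <= n)%N -> a n <= q ^+ n.
Proof.
move=> q1 a0 la; have q0 : 0 <= q by rewrite (le_trans ler01)// ltW.
have [|N NP] := @limn_esup_lt (fun n => (a n `^ n%:R^-1)%:E) q%:E.
  by apply: le_lt_trans la _; rewrite lte_fin.
exists (maxn N 1) => n; rewrite geq_max => /andP[Nn n1].
have n0 : n%:R != 0 :> R by rewrite pnatr_eq0 -lt0n.
have -> : a n = (a n `^ n%:R^-1) ^+ n.
  by rewrite -powR_mulrn ?powR_ge0// -powRrM mulVf// powRr1.
by have := NP n Nn; rewrite lte_fin => /ltW h; rewrite lerXn2r ?nnegrE ?powR_ge0.
Qed.

Lemma eventually_dominated (c : nat -> R[i]) (K s : R) N : 0 < s ->
  (forall n, (N <= n)%N -> cnorm (c n) <= K * s ^+ n) ->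
  exists K', forall n, cnorm (c n) <= K' * s ^+ n.
Proof.
move=> s0 cK; pose S := \sum_(i < N) cnorm (c i) / s ^+ i.
have S0 i : 0 <= cnorm (c i) / s ^+ i by rewrite divr_ge0 ?cnorm_ge0 ?exprn_ge0 ?ltW.
exists (`|K| + S) => n; have [nN|Nn] := ltnP n N; last first.
  apply: le_trans (cK n Nn) _; rewrite ler_wpM2r ?exprn_ge0 ?(ltW s0)//.
  by rewrite (le_trans (ler_norm K))// lerDl sumr_ge0.
rewrite -ler_pdivrMr ?exprn_gt0// /S (bigD1 (Ordinal nN))//= addrCA lerDl addr_ge0//.
by rewrite sumr_ge0.
Qed.

End RootTest.

Section CauchyDual.
Variables (R : realType) (X : completeNormedModType R[i]) (ev : X -> R[i] -> R[i]).
Hypothesis sa : standing_assumptions ev.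
Local Notation nrm := (nrm (@ip R)).
Local Notation e n := (polyL2 ('X^n : {poly R[i]})).
Let H := @semi_inner_ip R.

Lemma ext_inj (b c : L2 R) : hardy b -> hardy c -> eq_on_disc (ext b) (ext c) ->
  nrm (b - c) = 0.
Proof.
move=> hb hc bc; have hw := hardyB hb hc.
have : H2norm (ext (b - c)) = H2norm (ext (polyL2 (0 : {poly R[i]}))).
  by apply: H2norm_eq => z dz; rewrite extB// bc// subrr ext_poly horner0.
rewrite !H2norm_ext//; last exact: hardy_poly.
by rewrite polyL2_0 (nrm0 H) => -[].
Qed.

(** The choice of boundary functions is linear only up to null functions, which
    is what [bdry_linear] says. *)
Lemma bdry_exists : exists B : X -> L2 R, forall x,
  hardy (B x) /\ eq_on_disc (ev x) (ext (B x)).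
Proof.
have /choice[B BP] : forall x : X, exists b : L2 R, hardy b /\ eq_on_disc (ev x) (ext b).
  move=> x; have [c /(_ x)[/H2_hardy[b hb xb] _]] := sa_embedding sa.
  by exists b.
by exists B.
Qed.

Variable B : X -> L2 R.
Hypothesis hB : forall x, hardy (B x).
Hypothesis extB_ev : forall x, eq_on_disc (ev x) (ext (B x)).

Lemma bdry_poly x (p : {poly R[i]}) : eq_on_disc (ev x) (horner p) ->
  nrm (B x - polyL2 p) = 0.
Proof.
move=> xp; apply: ext_inj; [exact: hB|exact: hardy_poly|].
by move=> z dz; rewrite -extB_ev// xp// ext_poly.
Qed.

Lemma bdry_linear a x y : nrm (B (a *: x + y) - (a *: B x + B y)) = 0.
Proof.
apply: ext_inj; [exact: hB|by apply: hardy_linear; exact: hB|].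
by move=> z dz; rewrite -extB_ev// (sa_linear sa)// ext_linear// !extB_ev.
Qed.

Lemma bdry_bounded : exists2 c, 0 <= c & forall x, nrm (B x) <= c * rnorm x.
Proof.
have [c xc] := sa_embedding sa; exists `|c| => // x.
have [_] := xc x; rewrite (H2norm_eq (@extB_ev x)) H2norm_ext// lee_fin.
by move=> /le_trans; apply; rewrite ler_wpM2r ?rnorm_ge0// ler_norm.
Qed.

Lemma monomialP n : eq_on_disc (ev (monomial ev n)) (fun z => z ^+ n).
Proof.
have [x xn] := sa_polynomials sa 'X^n.
suff : [set x | eq_on_disc (ev x) (fun z => z ^+ n)] (monomial ev n) by [].
by apply: (@xgetPex _ 0); exists x => z dz; rewrite xn// hornerXn.
Qed.

Lemma bdry_monomial n : nrm (B (monomial ev n) - e n) = 0.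
Proof. by apply: bdry_poly => z dz; rewrite monomialP// hornerXn. Qed.

Lemma ip_bdry_monomial n (g : L2 R) : ip (B (monomial ev n)) g = ip (e n) g.
Proof.
by apply/eqP; rewrite -subr_eq0 -(ipBl H) (ip_null_l H)// bdry_monomial.
Qed.

(** The Cauchy pairing with the function [ext g] of the dual, by
    [cauchy_transform_pairing]. *)
Definition pairing (g : L2 R) : X -> R[i]^o := fun x => ip (B x) g.

Lemma pairingE g x : pairing g x = ip (B x) g.
Proof. by []. Qed.

Lemma pairing_linear g a x y :
  pairing g (a *: x + y) = a * pairing g x + pairing g y.
Proof.
apply/eqP; rewrite -subr_eq0 /pairing -(ip_linear H) -(ipBl H).
by rewrite (ip_null_l H)// bdry_linear.
Qed.

Lemma pairing_bounded g : exists2 c, 0 <= c & forall x, cnorm (pairing g x) <= c * rnorm x.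
Proof.
have [c c0 Bc] := bdry_bounded; exists (c * nrm g); first by rewrite mulr_ge0 ?nrm_ge0.
move=> x; apply: le_trans (cauchy_schwarz H _ _) _.
by rewrite mulrAC ler_wpM2r ?nrm_ge0.
Qed.

Lemma dual_pairing g : dual (pairing g : {ptws X -> R[i]^o}).
Proof.
have [c _ gc] := pairing_bounded g; apply: dual_of_bounded gc.
exact: pairing_linear.
Qed.

Lemma cauchy_transform_pairing g z : cauchy_transform ev (pairing g) z = ext g z.
Proof.
rewrite extE /cauchy_transform.
suff -> : (fun n => conjc (pairing g (monomial ev n)) * z ^+ n : R[i]^o) =
     (fun n => ip g (e n) * z ^+ n) by [].
by apply/funext => n; rewrite /pairing ip_bdry_monomial -(ip_conj H).
Qed.

(** For a bounded functional the coefficients are dominated by the norms of the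
    monomials, which grow slower than every [q ^+ n] with [q > 1]. *)
Lemma cauchy_transform_cvg (L : {ptws X -> R[i]^o}) z : dual L -> disc z ->
  series (fun n => conjc (L (monomial ev n)) * z ^+ n : R[i]^o) @ \oo -->
    (cauchy_transform ev L z : R[i]^o).
Proof.
move=> /dual_bounded[_ [c c0 Lc]] /discE z1.
have z0 := cnorm_ge0 z.
have z1' : 0 < 1 + cnorm z by rewrite ltr_wpDr.
(* Any q with 1 < q < 1 / |z| would do; s lies between q |z| and 1. *)
pose q := 2 / (1 + cnorm z).
have q1 : 1 < q by rewrite /q ltr_pdivlMr// mul1r; lra.
have [N NP] := root_test_bound q1 (fun n => rnorm_ge0 (monomial ev n)) (sa_monomials sa).
pose s := (1 + q * cnorm z) / 2.
have qz : q * cnorm z < 1.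
  by rewrite /q mulrAC ltr_pdivrMr// mul1r; lra.
have qz0 : 0 <= q * cnorm z by rewrite mulr_ge0// (le_trans ler01)// ltW.
have [s0 s1 qs] : [/\ 0 < s, s < 1 & q * cnorm z <= s] by rewrite /s; split; lra.
have [|K cK] := @eventually_dominated _
    (fun n => conjc (L (monomial ev n)) * z ^+ n) c s N s0.
  move=> n /NP Nn; rewrite cnormM cnormJ cnormX.
  apply: (@le_trans _ _ (c * q ^+ n * cnorm z ^+ n)).
    rewrite ler_wpM2r ?exprn_ge0//; apply: le_trans (Lc _) _.
    by rewrite ler_wpM2l.
  by rewrite -mulrA -exprMn ler_wpM2l// lerXn2r ?nnegrE// ltW.
have s01 : 0 <= s < 1 by rewrite ltW.
have [l cl _] := dominated_series_cvg s01 cK.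
by have -> : cauchy_transform ev L z = l by exact: cvg_lim cl.
Qed.

(** The Cauchy transform determines the values on the monomials, hence on
    polynomials, which are dense. *)
Lemma dual_pairing_eq (L : {ptws X -> R[i]^o}) g : dual L ->
  eq_on_disc (ext g) (cauchy_transform ev L) -> L = pairing g.
Proof.
move=> dL gL.
have coef n : conjc (L (monomial ev n)) = ip g (e n).
  apply/eqP; rewrite -subr_eq0; apply/eqP.
  apply: (@power_series_unique R (fun n => conjc (L (monomial ev n)) - ip g (e n))).
  move=> z dz; have [gz _] := ext_spec g dz.
  have := @cseries_linear_cvg R (-1) _ _ _ _ gz (cauchy_transform_cvg dL dz).
  have -> : -1 * ext g z + cauchy_transform ev L z = 0.
    by rewrite (gL z dz) mulN1r addNr.
  suff <- : (fun n => -1 * (ip g (e n) * z ^+ n) + conjc (L (monomial ev n)) * z ^+ n)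
    = (fun n => (conjc (L (monomial ev n)) - ip g (e n)) * z ^+ n) by [].
  by apply/funext => k; rewrite mulrBl mulN1r addrC.
have [Llin [c c0 Lc]] := dual_bounded dL; have [d d0 gd] := pairing_bounded g.
apply: (bounded_eq_dense (sa_polynomials_dense sa) c0 d0 Llin _ Lc gd).
  exact: pairing_linear.
move=> x [p xp].
have -> : x = \sum_(i < size p) p`_i *: monomial ev i.
  apply: (sa_injective sa) => z dz; rewrite xp// horner_coef.
  have sumE m : ev (\sum_(i < m) p`_i *: monomial ev i) z = \sum_(i < m) p`_i * z ^+ i.
    elim: m => [|m IH].
      rewrite !big_ord0; have := sa_linear sa (-1) 0 0 dz.
      by rewrite scaler0 addr0 mulN1r addNr.
    rewrite !big_ord_recr /= addrC (sa_linear sa)// IH monomialP//.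
    by rewrite addrC.
  by rewrite sumE.
have lin_sum (f : X -> R[i]^o) : (forall a u v, f (a *: u + v) = a * f u + f v) ->
    f (\sum_(i < size p) p`_i *: monomial ev i) =
    \sum_(i < size p) p`_i * f (monomial ev i).
  move=> flin; elim: (size p) => [|m IH].
    by rewrite !big_ord0; exact: (linear_functional0 flin).
  by rewrite !big_ord_recr /= addrC flin IH addrC.
rewrite (lin_sum _ Llin) (lin_sum _ (@pairing_linear g)); apply: eq_bigr => i _.
by rewrite /pairing ip_bdry_monomial (ip_conj H) -coef conjcK.
Qed.

End CauchyDual.

(** * The P-property and density in the model space *)

Section PProperty.
Variables (R : realType) (X : completeNormedModType R[i]) (ev : X -> R[i] -> R[i]).
Hypothesis sa : standing_assumptions ev.
Variable B : X -> L2 R.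
Hypothesis hB : forall x, hardy (B x).
Hypothesis extB_ev : forall x, eq_on_disc (ev x) (ext (B x)).
Variables (theta : R[i] -> R[i]) (tb : R -> R[i]).
Hypothesis inner : inner_function theta.
Hypothesis tb_boundary : boundary_function theta tb.
Hypothesis tb1 : {ae @lebesgue_measure R,
  forall t, [set` `[0%R : R, 1%R]] t -> cnorm (tb t) = 1}.
Local Notation nrm := (nrm (@ip R)).
Local Notation W := (mulL2 tb).
Local Notation coinvariant := (coinvariant tb).
Local Notation pairing := (pairing B).
Let H := @semi_inner_ip R.

Let tb_bounded : ess_bounded 1 tb.
Proof. exact: inner_ess_bounded tb_boundary tb1. Qed.

Lemma model_space_ev x : model_space theta (ev x) <-> coinvariant (B x).
Proof.
split; first exact: model_space_coinvariant (hB x) (@extB_ev x).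
move=> /(model_space_ext inner tb_boundary tb1); exact/model_space_eq/extB_ev.
Qed.

Let theta_pairings : set (X -> R[i]) :=
  [set f | exists q : {poly R[i]}, f = pairing (W (polyL2 q))].

Lemma pairing_theta_poly (L : {ptws X -> R[i]^o}) f : dual L ->
  poly_multiples theta f -> eq_on_disc f (cauchy_transform ev L) -> theta_pairings L.
Proof.
move=> dL [q fq] fL; exists q.
apply: (dual_pairing_eq sa hB extB_ev dL) => z dz; rewrite -fL// fq//.
by rewrite (ext_W inner tb_boundary tb1 (hardy_poly q) dz) ext_poly.
Qed.

(** The common kernel of the functionals induced by [theta] times polynomials
    consists of the elements of [X] in the model space, so this is the bipolar
    theorem. *)
Lemma weak_star_closure_ext g : hardy g ->
  (forall x, coinvariant (B x) -> ip (B x) g = 0) ->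
  weak_star_closure ev (poly_multiples theta) (ext g).
Proof.
move=> hg g0; exists (pairing g); split.
- exact: (dual_pairing sa hB extB_ev).
- by move=> z _; rewrite (cauchy_transform_pairing sa hB extB_ev).
apply: (@closureS _ (theta_pairings : set {ptws X -> R[i]^o})).
  move=> _ [q ->]; split; first exact: (dual_pairing sa hB extB_ev).
  exists (ext (W (polyL2 q))); last first.
    by move=> z _; rewrite (cauchy_transform_pairing sa hB extB_ev).
  exists q => z dz.
  by rewrite (ext_W inner tb_boundary tb1 (hardy_poly q) dz) ext_poly.
apply: interpolation_closure => s.
apply: bipolar_interpolation.
- exists 0; apply/funext => x.
  by rewrite !pairingE polyL2_0 (W0 tb_boundary tb1) (ip0r H).
- move=> a _ _ [q ->] [q' ->]; exists (conjc a *: q + q'); apply/funext => x.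
  rewrite !pairingE polyL2D polyL2Z (mulL2_linear _ _ _ tb_bounded).
  by rewrite (ipDr H) (ipZr H) conjcK.
- by move=> _ [q ->] a x y; exact: (pairing_linear sa hB extB_ev).
- by move=> a x y; exact: (pairing_linear sa hB extB_ev).
move=> x xA; apply: g0; split; first exact: hB.
by move=> n; apply: (xA (pairing (W (polyL2 'X^n)))); exists 'X^n.
Qed.

(** Evaluation at [x] is weak-star continuous. *)
Lemma weak_star_closure_ip g : hardy g ->
  weak_star_closure ev (poly_multiples theta) (ext g) ->
  forall x, coinvariant (B x) -> ip (B x) g = 0.
Proof.
move=> hg [L [dL gL cL]] x cx.
have -> : ip (B x) g = L x by rewrite (dual_pairing_eq sa hB extB_ev dL gL).
apply: (closure_eval cL) => L' [dL' [f qf fL']].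
have [q ->] := pairing_theta_poly dL' qf fL'.
exact: (coinvariant_ip tb_boundary tb1 cx (hardy_poly q)).
Qed.

Lemma weak_star_closure_eq (A : set (R[i] -> R[i])) f g : eq_on_disc f g ->
  weak_star_closure ev A f -> weak_star_closure ev A g.
Proof. by move=> fg [L [dL fL cL]]; exists L; split => // z dz; rewrite -fg// fL. Qed.

Lemma H2norm_sub_ev (f : R[i] -> R[i]) b x : hardy b -> eq_on_disc f (ext b) ->
  H2norm (fun z => f z - ev x z) = (nrm (b - B x))%:E.
Proof.
move=> hb fb; rewrite -H2norm_ext; last exact: hardyB.
by apply: H2norm_eq => z dz; rewrite extB// fb// extB_ev.
Qed.

Lemma P_property_of_dense : dense_in_model_space ev theta -> P_property ev theta.
Proof.
move=> dense f [wf H2f]; have [g hg fg] := H2_hardy H2f.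
have g0 := weak_star_closure_ip hg (weak_star_closure_eq fg wf).
have [h hh cF] := model_decomposition inner tb_boundary tb1 hg.
set F := g - W h in cF; have [hF _] := cF.
have Fg : ip F g = 0.
  apply: (ip_eq0_closure H) => d d0.
  have [x [xM Fx]] := dense _ (model_space_ext inner tb_boundary tb1 cF) d d0.
  exists (B x); first by apply: g0; exact/model_space_ev.
  move: Fx; rewrite (@H2norm_sub_ev _ F) ?lte_fin//.
have F0 : nrm F = 0.
  apply/eqP; rewrite -sqrf_eq0 (nrm_sqr H).
  have -> : ip F F = ip F g - ip F (W h) by exact: (ipBr H).
  by rewrite Fg (coinvariant_ip tb_boundary tb1 cF hh) subrr.
exists (ext h); first exact: H2_ext.
move=> z dz; rewrite fg// -(ext_W inner tb_boundary tb1 hh dz).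
exact: ext_null F0 dz.
Qed.

Lemma dense_of_P_property : P_property ev theta -> dense_in_model_space ev theta.
Proof.
move=> P f fK d d0; have [H2f _] := fK; have [F hF fF] := H2_hardy H2f.
have cF := model_space_coinvariant inner tb_boundary tb1 hF fF fK.
(* The set of all B x is not a subspace, B being linear only up to null
   functions; closing it under these gives one without changing distances. *)
pose M := [set b : L2 R | exists2 x, coinvariant (B x) & nrm (b - B x) = 0].
have ip_M b x y : nrm (b - B x) = 0 -> ip b y = ip (B x) y.
  by move=> bx; apply/eqP; rewrite -subr_eq0 -(ipBl H) (ip_null_l H).
have Mcoinv b n : M b -> ip b (W (polyL2 'X^n)) = 0.
  by move=> [x [_ cx] bx]; rewrite (ip_M _ _ _ bx).
have M_lin a b c : M b -> M c -> M (a *: b + c).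
  move=> Mb Mc; have [x _ bx] := Mb; have [y _ cy] := Mc.
  have ax : nrm (a *: b + c - B (a *: x + y)) = 0.
    apply/eqP; rewrite eq_le nrm_ge0 andbT.
    apply: le_trans (nrmB_le H _ (a *: B x + B y) _) _.
    rewrite (nrm_distrC H (a *: B x + B y)) (bdry_linear sa hB extB_ev) addr0.
    rewrite opprD addrACA -scalerBr; apply: le_trans (nrmD H _ _) _.
    by rewrite (nrmZ H) bx cy mulr0 addr0.
  exists (a *: x + y) => //; split=> [|n]; first exact: hB.
  rewrite -(ip_M _ _ _ ax) (ip_linear H) (Mcoinv _ _ Mb) (Mcoinv _ _ Mc).
  by rewrite mulr0 addr0.
have M0 : M 0.
  have B0 : nrm (0 - B 0) = 0.
    rewrite (nrm_distrC H); have := bdry_poly hB extB_ev (x := 0) (p := 0).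
    rewrite polyL2_0; apply=> z dz; rewrite horner0.
    have := sa_linear sa (-1) 0 0 dz.
    by rewrite scaler0 addr0 mulN1r addNr.
  exists 0 => //; split=> [|n]; first exact: hB.
  by rewrite -(ip_M _ _ _ B0) (ip0l H).
have [m Fm mM] := projection H (@L2_complete R) F M0 M_lin.
have hm : hardy m.
  apply: hardy_closed => k /mM[b [x _ bx] mb]; exists b => //.
  exact: hardy_null (hB x) bx.
pose G := F - m.
have hG : hardy G by exact: hardyB.
have cG : coinvariant G.
  split=> // n; rewrite (ipBl H); case: (cF) => _ ->.
  suff -> : ip m (W (polyL2 'X^n)) = 0 by rewrite subrr.
  by apply: (ip_eq0_closure H) => k /mM[b Mb mb]; exists b => //; exact: Mcoinv.
have wG : weak_star_closure ev (poly_multiples theta) (ext G).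
  apply: weak_star_closure_ext => // x cx; rewrite (ip_conj H) Fm ?conjc0//.
  by exists x => //; rewrite subrr (nrm0 H).
have [h0 H2h0 Gh0] := P _ (conj wG (H2_ext hG)).
have [h hh h0h] := H2_hardy H2h0.
have Gh : nrm (G - W h) = 0.
  apply: ext_inj => //; first exact: hardy_W inner tb_boundary tb1 _ hh.
  by move=> z dz; rewrite Gh0// (ext_W inner tb_boundary tb1 hh dz) h0h.
have G0 : nrm G = 0.
  apply/eqP; rewrite -sqrf_eq0 (nrm_sqr H).
  rewrite (_ : ip G G = ip G (G - W h) + ip G (W h)).
    rewrite (ip_null_r H _ Gh) (coinvariant_ip tb_boundary tb1 cG hh).
    by rewrite addr0.
  by rewrite -(ipDr H) subrK.
have [b [x cx bx] mb] := mM _ d0.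
exists x; split; first exact/model_space_ev.
rewrite (H2norm_sub_ev x hF fF) lte_fin.
apply: le_lt_trans (nrmB_le H _ m _) _; rewrite -/G G0 add0r.
by apply: le_lt_trans (nrmB_le H _ b _) _; rewrite bx addr0.
Qed.

End PProperty.

Theorem theorem1p3 (R : realType) (X : completeNormedModType R[i])
    (ev : X -> R[i] -> R[i]) (theta : R[i] -> R[i]) :
  standing_assumptions ev -> inner_function theta ->
  P_property ev theta <-> dense_in_model_space ev theta.
Proof.
move=> sa inner; have [B BP] := bdry_exists sa.
have hB x : hardy (B x) by case: (BP x).
have extB_ev x : eq_on_disc (ev x) (ext (B x)) by case: (BP x).
have [_ _ [tb tb_boundary tb1]] := inner.
split.
  exact: (dense_of_P_property sa hB extB_ev inner tb_boundary tb1).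
exact: (P_property_of_dense sa hB extB_ev inner tb_boundary tb1).
Qed.
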